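(* Let $\mathcal I\subsetneq\mathcal B(\mathcal H)$ be a symmetrically normed ideal. The following conditions are equivalent: (i) The ideal $\mathcal I$ is separable. (ii) For every normal operator $a\in\mathcal I$ one has $\overline{\mathcal O_{\mathcal B(\mathcal H)}(a)}^{\|\cdot\|}\subseteq\overline{\mathcal O_{\mathcal F(\mathcal H)}(a)}^{\|\cdot\|_{\mathcal I}}$. (iii) For every operator $a\in\mathcal I$ with $a\ge0$ one has $\mathcal O_{\mathcal B(\mathcal H)}(a)\subseteq\overline{\mathcal O_{\mathcal F(\mathcal H)}(a)}^{\|\cdot\|_{\mathcal I}}$. If any of these conditions is satisfied, then for any normal $a\in\mathcal I$ one has $$\overline{\mathcal O_{\mathcal F(\mathcal H)}(a)}^{\|\cdot\|_{\mathcal I}}=\overline{\mathcal O_{\mathcal I}(a)}^{\|\cdot\|_{\mathcal I}}=\overline{\mathcal O_{\mathcal B(\mathcal H)}(a)}^{\|\cdot\|_{\mathcal I}}=\overline{\mathcal O_{\mathcal B(\mathcal H)}(a)}^{\|\cdot\|}.$$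
   Context: $\mathcal H$ is a separable infinite-dimensional complex Hilbert space, $\mathcal B(\mathcal H)$ the bounded operators with operator norm $\|\cdot\|$, $\mathcal F(\mathcal H)$ the finite-rank operators, $\mathrm U(\mathcal H)$ the unitary group, $\mathbf 1$ the identity. A symmetrically normed ideal is a nonzero two-sided ideal $\mathcal I\subseteq\mathcal B(\mathcal H)$ with a norm $\|\cdot\|_{\mathcal I}$ making it a Banach space, with $\|axb\|_{\mathcal I}\le\|a\|\,\|x\|_{\mathcal I}\|b\|$ for $x\in\mathcal I$, $a,b\in\mathcal B(\mathcal H)$, normalized to be $1$ on rank-one projections; separability refers to $(\mathcal I,\|\cdot\|_{\mathcal I})$. For any two-sided ideal $\mathcal J\subseteq\mathcal B(\mathcal H)$ put $\mathrm U_{\mathcal J}:=(\mathbf 1+\mathcal J)\cap\mathrm U(\mathcal H)$ and $\mathcal O_{\mathcal J}(a):=\{uau^*\mid u\in\mathrm U_{\mathcal J}\}$; in particular $\mathcal O_{\mathcal B(\mathcal H)}(a)$ is the full unitary orbit. $\overline{S}^{\|\cdot\|}$ is the closure in the operator norm and $\overline{S}^{\|\cdot\|_{\mathcal I}}$ the closure in $(\mathcal I,\|\cdot\|_{\mathcal I})$. *)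

(* Defs.v *)
From mathcomp Require Import all_boot all_order all_algebra.
From mathcomp Require Import complex.
From mathcomp Require Import all_classical all_reals all_analysis.
Import Order.TTheory GRing.Theory Num.Theory.
Import numFieldNormedType.Exports.

Set Implicit Arguments.
Unset Strict Implicit.
Unset Printing Implicit Defensive.

Local Open Scope classical_set_scope.
Local Open Scope ring_scope.
Local Open Scope complex_scope.

Section HilbertSpace.
Variables (R : realType) (H : completeNormedModType R[i]).

(* The norms of [R[i]] and of [H] take values in [R[i]]; these are the same
   norms with values in [R]. *)
Definition cnorm (c : R[i]) : R := complex.Re `|c|.
Definition hnorm (x : H) : R := complex.Re `|x|.

(* [dot] is linear on the left and conjugate-linear on the right; completeness
   of [H] is part of its type. *)
Definition hilbert_inner_product (dot : {dot H for Num.conj}) : Prop :=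
  forall x : H, dot x x = `|x| ^+ 2.

Definition separable_space : Prop :=
  exists2 D : set H, countable D & dense D.

(* For a linear subspace [A], being contained in the span of finitely many
   vectors amounts to being finite-dimensional. *)
Definition finite_dim (A : set H) : Prop :=
  exists (n : nat) (e : 'I_n -> H),
    A `<=` [set \sum_(i < n) c i *: e i | c in [set: 'I_n -> R[i]]].

(* Operators are plain functions [H -> H]; sums and scalar multiples are the
   pointwise ones and products are compositions. *)
Definition bounded_ops : set (H -> H) :=
  [set a | linear a /\ exists M : R, forall x, hnorm (a x) <= M * hnorm x].

Definition opnorm (a : H -> H) : R :=
  sup [set hnorm (a x) | x in [set x | hnorm x <= 1]].

Definition finite_rank_ops : set (H -> H) :=
  [set a | bounded_ops a /\ finite_dim (range a)].

Record two_sided_ideal (J : set (H -> H)) : Prop := TwoSidedIdeal {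
  tsi_bounded : J `<=` bounded_ops ;
  tsi0 : J 0 ;
  tsiD : forall x y, J x -> J y -> J (x + y) ;
  tsiMl : forall a x, bounded_ops a -> J x -> J (a \o x) ;
  tsiMr : forall x b, J x -> bounded_ops b -> J (x \o b) }.

(* In the next definitions [N : (H -> H) -> R] is a norm on a linear space [E]
   of operators; its values outside [E] are irrelevant. *)
Record norm_on (E : set (H -> H)) (N : (H -> H) -> R) : Prop := NormOn {
  norm_on_ge0 : forall x, E x -> 0 <= N x ;
  norm_on_eq0 : forall x, E x -> N x = 0 -> x = 0 ;
  norm_onZ : forall (c : R[i]) x, E x -> N (c *: x) = cnorm c * N x ;
  norm_onD : forall x y, E x -> E y -> N (x + y) <= N x + N y }.

Definition complete_on (E : set (H -> H)) (N : (H -> H) -> R) : Prop :=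
  forall u : nat -> H -> H, (forall n, E (u n)) ->
    (forall e : R, 0 < e -> exists n0 : nat, forall m n : nat,
       (n0 <= m)%N -> (n0 <= n)%N -> N (u m - u n) < e) ->
    exists2 l, E l & (fun n => N (u n - l)) @ \oo --> (0 : R).

(* The closure of [S] in the normed space [(E, N)]. *)
Definition norm_closure (E : set (H -> H)) (N : (H -> H) -> R)
    (S : set (H -> H)) : set (H -> H) :=
  [set b | E b /\ forall e : R, 0 < e -> exists2 s, S s & N (b - s) < e].

Definition separable_on (E : set (H -> H)) (N : (H -> H) -> R) : Prop :=
  exists D : set (H -> H), [/\ countable D, D `<=` E & E `<=` norm_closure E N D].

Variable dot : {dot H for Num.conj}.

(* By the Riesz representation theorem the set below is a singleton whenever
   [a] is a bounded operator and [dot] is a Hilbert inner product. *)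
Definition adjoint (a : H -> H) : H -> H :=
  xget 0 [set b | bounded_ops b /\ forall x y, dot (a x) y = dot x (b y)].

Definition normal_op (a : H -> H) : Prop :=
  bounded_ops a /\ a \o adjoint a = adjoint a \o a.

(* In [R[i]], [0 <= z] means that [z] is real and nonnegative. *)
Definition positive_op (a : H -> H) : Prop :=
  bounded_ops a /\ forall x, 0 <= dot (a x) x.

Definition unitary_ops : set (H -> H) :=
  [set u | [/\ bounded_ops u, u \o adjoint u = idfun & adjoint u \o u = idfun]].

Definition rank_one_projection (p : H -> H) : Prop :=
  [/\ bounded_ops p, p \o p = p, adjoint p = p &
      exists2 e : H, e != 0 & range p = [set c *: e | c in [set: R[i]]]].

Record symmetrically_normed_ideal (J : set (H -> H)) (N : (H -> H) -> R) : Prop :=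
  SymmetricallyNormedIdeal {
    sni_ideal : two_sided_ideal J ;
    sni_nonzero : exists2 x, J x & x <> 0 ;
    sni_norm : norm_on J N ;
    sni_complete : complete_on J N ;
    sni_symmetric : forall a x b, bounded_ops a -> J x -> bounded_ops b ->
      N (a \o x \o b) <= opnorm a * N x * opnorm b ;
    sni_normalized : forall p, rank_one_projection p -> N p = 1 }.

Definition unitary_group (J : set (H -> H)) : set (H -> H) :=
  [set u | unitary_ops u /\ J (u - idfun)].

Definition unitary_orbit (J : set (H -> H)) (a : H -> H) : set (H -> H) :=
  [set u \o a \o adjoint u | u in unitary_group J].

Definition normal_orbit_closures_included (J : set (H -> H))
    (N : (H -> H) -> R) : Prop :=
  forall a, J a -> normal_op a ->
    norm_closure bounded_ops opnorm (unitary_orbit bounded_ops a)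
      `<=` norm_closure J N (unitary_orbit finite_rank_ops a).

Definition positive_orbits_included (J : set (H -> H))
    (N : (H -> H) -> R) : Prop :=
  forall a, J a -> positive_op a ->
    unitary_orbit bounded_ops a
      `<=` norm_closure J N (unitary_orbit finite_rank_ops a).

End HilbertSpace.

Arguments bounded_ops {R} H.
Arguments finite_rank_ops {R} H.
Arguments separable_space {R} H.

(* Main.v *)
Require Import Defs.
From mathcomp Require Import all_boot all_order all_algebra.
From mathcomp Require Import complex.
From mathcomp Require Import all_classical all_reals all_analysis.
From mathcomp Require Import ring lra.
Import Order.TTheory GRing.Theory Num.Theory.
Import numFieldNormedType.Exports.

Local Open Scope classical_set_scope.
Local Open Scope ring_scope.
Local Open Scope complex_scope.

(**
  The ideal is tested against finite-rank projections [p]; everything rests on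
  how well [p a] and [a p] approximate [a] in the norm of the ideal.

  Suppose that the ideal is separable and let [p_n] be the projection onto the
  span of the first [n] vectors of an orthonormal basis. Then [a p_n] and
  [p_n a] converge to [a] in the ideal (separable_approx). If [a p_n] were not
  Cauchy, there would be disjoint blocks of basis vectors on each of which [a]
  has ideal norm at least [eps]; cutting [a] down to all possible unions of
  blocks would give uncountably many elements at mutual distance at least [eps]
  (separable_blocks). The limit is [a] because the ideal norm dominates the
  operator norm. This has two consequences for unitary orbits.
  - A unitary [u] can be replaced by a unitary [v] with [v - 1] of finite rank
    and [v p = u p], a product of rank-one perturbations of the identity
    (unitary_finite_rank_extension). The conjugates of [p a p] by [u] and [v]
    agree, so those of [a] are close, and the full orbit lies in the closure of
    the orbit under the finite-rank unitary group (conj_op_finite_rank).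
  - If [p] has rank [n], the difference [d] of two conjugates of [a] splits into
    two terms that factor through a projection of rank [n], hence have ideal
    norm at most [n |d|], and a small term (orbit_norm_le). So sequences in the
    orbit that are Cauchy for the operator norm are Cauchy in the ideal, and the
    two closures of the orbit coincide (orbit_opnorm_closure).
  This gives (ii) and the four equal closures. Positive operators are normal, so
  (ii) implies (iii).

  Suppose (iii). Conjugation by a unitary of the form 1 + finite rank changes an
  operator by a finite-rank one, so (iii) says that [w b w^* - b] is a limit of
  finite-rank operators for every positive [b] in the ideal and every unitary
  [w]. Let [s] and [t] be isometries with complementary ranges
  (hilbert_hotel), [b := s a s^*], and let [w] exchange the two ranges: then
  [t a t^* - s a s^*] is such a limit, and so is its compression by [t], which
  is [a] (positive_approximable). By the polar decomposition every element of
  the ideal is a multiple of a positive one (polar_decomposition), so the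
  finite-rank operators are dense. They are the limits of finite sums of
  operators [x |-> <x, d_k> d_l] for a dense sequence [d], which are countably
  many (approximable_separable).
*)

Section Hilbert.
Set Implicit Arguments.
Unset Strict Implicit.
Unset Printing Implicit Defensive.
Variables (R : realType) (H : completeNormedModType R[i]).
Variable dot : {dot H for Num.conj}.
Hypothesis hdot : hilbert_inner_product dot.
Local Notation "''[' u , v ]" := (dot u v) : ring_scope.

(** * Norms and inner products *)

Lemma ge0_ReE (z : R[i]) : 0 <= z -> z = (complex.Re z)%:C.
Proof. by move=> z0; rewrite RRe_real// ger0_real. Qed.

Lemma cnormE (c : R[i]) : `|c| = (cnorm c)%:C.
Proof. by rewrite /cnorm -ge0_ReE. Qed.

Lemma hnormE (x : H) : `|x| = (hnorm x)%:C.
Proof. by rewrite /hnorm -ge0_ReE. Qed.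

Lemma cnorm_ge0 (c : R[i]) : 0 <= cnorm c.
Proof. by rewrite -ler0c -cnormE. Qed.

Lemma hnorm_ge0 (x : H) : 0 <= hnorm x.
Proof. by rewrite -ler0c -hnormE. Qed.

Lemma hnorm0 : hnorm (0 : H) = 0.
Proof. by rewrite /hnorm normr0. Qed.

Lemma hnorm_eq0 (x : H) : hnorm x = 0 -> x = 0.
Proof. by move=> h; apply/eqP; rewrite -normr_eq0 hnormE h. Qed.

Lemma hnorm_opp (x : H) : hnorm (- x) = hnorm x.
Proof. by rewrite /hnorm normrN. Qed.

Lemma hnorm_add (x y : H) : hnorm (x + y) <= hnorm x + hnorm y.
Proof. by rewrite -lecR rmorphD /= -!hnormE ler_normD. Qed.

Lemma hdistC (x y : H) : hnorm (x - y) = hnorm (y - x).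
Proof. by rewrite -hnorm_opp opprB. Qed.

Lemma hnorm_trans (y x z : H) : hnorm (x - z) <= hnorm (x - y) + hnorm (y - z).
Proof. by rewrite (le_trans _ (hnorm_add _ _))// subrKA. Qed.

Lemma cnormD (x y : R[i]) : cnorm (x + y) <= cnorm x + cnorm y.
Proof. by rewrite -lecR rmorphD /= -!cnormE ler_normD. Qed.

Lemma cnormM (x y : R[i]) : cnorm (x * y) = cnorm x * cnorm y.
Proof. by apply: complexI; rewrite rmorphM /= -!cnormE normrM. Qed.

Lemma cnorm_eq0 (x : R[i]) : cnorm x = 0 -> x = 0.
Proof. by move=> h; apply/eqP; rewrite -normr_eq0 cnormE h. Qed.

Lemma cnormR (r : R) : 0 <= r -> cnorm r%:C = r.
Proof. by move=> r0; rewrite /cnorm ger0_norm ?ler0c. Qed.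

Lemma hnormZ (c : R[i]) (x : H) : hnorm (c *: x) = cnorm c * hnorm x.
Proof. by apply: complexI; rewrite rmorphM /= -cnormE -!hnormE normrZ. Qed.

Lemma cnormJ (c : R[i]) : cnorm (Num.conj c) = cnorm c.
Proof. by rewrite /cnorm norm_conjC. Qed.

Lemma dotC x y : '[x, y] = Num.conj '[y, x].
Proof. by rewrite hermitian_subproof expr0 mul1r. Qed.

Lemma dotZl c x y : '[c *: x, y] = c * '[x, y].
Proof. exact: linearZl_LR. Qed.

Lemma dotZr c x y : '[x, c *: y] = Num.conj c * '[x, y].
Proof. exact: linearZr_LR. Qed.

Lemma dotxx x : '[x, x] = (hnorm x ^+ 2)%:C.
Proof. by rewrite hdot hnormE rmorphXn. Qed.

Lemma conj_realC (r : R) : Num.conj (r%:C : R[i]) = r%:C.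
Proof. exact: conjc_real. Qed.

Lemma mulJ_cnorm (c : R[i]) : c * Num.conj c = (cnorm c ^+ 2)%:C.
Proof. by rewrite -normCK cnormE rmorphXn. Qed.

Lemma pythagoras x y : '[x, y] = 0 ->
  hnorm (x + y) ^+ 2 = hnorm x ^+ 2 + hnorm y ^+ 2.
Proof.
move=> xy; apply: complexI; rewrite rmorphD /= -!dotxx.
by rewrite linearDl !linearDr/= [dot y x]dotC xy rmorph0 addr0 add0r.
Qed.

Lemma cauchy_schwarz x y : cnorm '[x, y] <= hnorm x * hnorm y.
Proof.
(* For a unit vector [e] this is the theorem of Pythagoras for the decomposition
   of [x] along [e]. *)
have unit e : hnorm e = 1 -> cnorm '[x, e] <= hnorm x.
  move=> e1; rewrite -(@ler_pXn2r _ 2) ?nnegrE ?cnorm_ge0 ?hnorm_ge0//.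
  have -> : x = '[x, e] *: e + (x - '[x, e] *: e) by rewrite addrC subrK.
  rewrite [X in _ <= X]pythagoras.
    rewrite hnormZ e1 mulr1 linearDl linearBl/= dotZl dotxx e1.
    by rewrite expr1n !mulr1 subrr addr0 lerDl sqr_ge0.
  by rewrite dotZl linearBr/= dotZr [dot e x]dotC dotxx e1 expr1n mulr1 subrr mulr0.
have [->|y0] := eqVneq y 0; first by rewrite linear0r hnorm0 mulr0 /cnorm normr0.
have hy : hnorm y != 0 by apply: contra_neq y0 => /hnorm_eq0.
have e1 : hnorm (((hnorm y)^-1)%:C *: y) = 1.
  by rewrite hnormZ cnormR ?invr_ge0 ?hnorm_ge0// mulVf.
have := unit _ e1; rewrite dotZr cnormM cnormJ cnormR ?invr_ge0 ?hnorm_ge0//.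
by rewrite mulrC ler_pdivrMr// lt_neqAle eq_sym hy hnorm_ge0.
Qed.

Lemma dot_eqP x y : (forall z, '[x, z] = '[y, z]) -> x = y.
Proof.
move=> h; apply/eqP; rewrite -subr_eq0; apply/eqP/hnorm_eq0.
have := dotxx (x - y); rewrite {1}linearBl/= h subrr => /complexI/esym/eqP.
by rewrite sqrf_eq0 => /eqP.
Qed.

(** * Limits of sequences *)

(** Distances in [H] are elements of [R[i]]; here they are compared in [R]. *)
Lemma hcvgP (u : nat -> H) l : u @ \oo --> l <->
  forall e : R, 0 < e -> exists n0, forall n, (n0 <= n)%N -> hnorm (u n - l) < e.
Proof.
split=> [/cvgrPdist_lt h e e0|h].
  have e0' : 0 < e%:C by rewrite ltcR.
  have [n0 _ hn0] := h _ e0'; exists n0 => n nn0.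
  by have := hn0 n nn0; rewrite /= hnormE ltcR hdistC.
apply/cvgrPdist_lt => e e0; rewrite (ge0_ReE (ltW e0)).
have /h[n0 hn0] : 0 < complex.Re e by rewrite -ltcR -ge0_ReE// ltW.
by exists n0 => // n /= nn0; rewrite hnormE ltcR hdistC hn0.
Qed.

Lemma hcauchy_cvg (u : nat -> H) :
  (forall e : R, 0 < e -> exists n0, forall m n, (n0 <= m)%N -> (m <= n)%N ->
     hnorm (u n - u m) < e) -> exists l : H, u @ \oo --> l.
Proof.
move=> h; suff : cvgn u by move=> /cvg_ex.
apply/cauchy_cvgP/cauchy_exP => e e0; rewrite (ge0_ReE (ltW e0)).
have /h[n0 hn0] : 0 < complex.Re e by rewrite -ltcR -ge0_ReE// ltW.
exists (u n0); exists n0 => // n /= nn0.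
by rewrite -ball_normE /= hnormE ltcR hdistC hn0.
Qed.

Lemma lim_hnorm_le (u : nat -> H) (l : H) (M : R) :
  u @ \oo --> l -> (forall n, hnorm (u n) <= M) -> hnorm l <= M.
Proof.
move=> /hcvgP ul uM; apply/ler_addgt0Pr => e e0.
have [n /(_ n (leqnn n)) h] := ul _ e0.
rewrite -[l](subrK (u n)) (le_trans (hnorm_add _ _))// addrC lerD//.
by rewrite hdistC ltW.
Qed.

Lemma lim_dot (u : nat -> H) (l y : H) : u @ \oo --> l ->
  forall e : R, 0 < e -> exists n0, forall n, (n0 <= n)%N ->
    cnorm ('[u n, y] - '[l, y]) < e.
Proof.
move=> /hcvgP ul e e0.
have y1 : 0 < hnorm y + 1 by rewrite ltr_wpDl ?hnorm_ge0.
have [|n0 hn0] := ul (e / (hnorm y + 1)); first by rewrite divr_gt0.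
exists n0 => n /hn0; rewrite ltr_pdivlMr// => /(le_lt_trans _); apply.
rewrite -linearBl (le_trans (cauchy_schwarz _ _))// ler_wpM2l ?hnorm_ge0//.
by rewrite lerDl.
Qed.

(** Carries an adjointness relation over from approximants to limits. *)
Lemma lim_dot_eq (u v : nat -> H) (k l x y : H) :
  u @ \oo --> k -> v @ \oo --> l ->
  (forall n, '[u n, y] = '[x, v n]) -> '[k, y] = '[x, l].
Proof.
move=> uk vl uv; apply/eqP; rewrite -subr_eq0; apply/eqP/cnorm_eq0.
apply/eqP; rewrite eq_le cnorm_ge0 andbT; apply/ler_addgt0Pr => e e0.
have e2 : 0 < e / 2 by rewrite divr_gt0.
have [n1 h1] := lim_dot y uk e2; have [n2 h2] := lim_dot x vl e2.
pose n := maxn n1 n2.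
have {h1} := h1 n (leq_maxl _ _); have {h2} := h2 n (leq_maxr _ _).
have -> : '[k, y] - '[x, l] =
    - ('[u n, y] - '[k, y]) + Num.conj ('[v n, x] - '[l, x]).
  by rewrite rmorphB/= -!dotC uv; ring.
move=> h2 h1; rewrite add0r (le_trans (cnormD _ _))// [leRHS]splitr.
by rewrite cnormJ {1}/cnorm normrN lerD// ltW.
Qed.

(** * Bounded operators *)

Definition rank_one (f e : H) (x : H) : H := dot x e *: f.

Lemma bop_id : bounded_ops H idfun.
Proof. by split => //; exists 1 => x; rewrite mul1r. Qed.

Lemma bopP (a : H -> H) : bounded_ops H a ->
  exists2 M, 0 < M & forall x, hnorm (a x) <= M * hnorm x.
Proof.
move=> [_ [M hM]]; exists (`|M| + 1) => [|x]; first by rewrite ltr_wpDl.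
by rewrite (le_trans (hM x))// ler_wpM2r ?hnorm_ge0// (le_trans (ler_norm _)) ?lerDl.
Qed.

Section Linear.
Variable a : H -> H.
Hypothesis ba : bounded_ops H a.

Lemma bop_lin c x y : a (c *: x + y) = c *: a x + a y.
Proof. by case: ba => + _; apply. Qed.

Lemma bopD x y : a (x + y) = a x + a y.
Proof. by rewrite -[x]scale1r bop_lin !scale1r. Qed.

Lemma bop0 : a 0 = 0.
Proof. by apply: (@addrI _ (a 0)); rewrite -bopD !addr0. Qed.

Lemma bopZ c x : a (c *: x) = c *: a x.
Proof. by rewrite -[c *: x]addr0 bop_lin bop0 addr0. Qed.

Lemma bopN x : a (- x) = - a x.
Proof. by rewrite -scaleN1r bopZ scaleN1r. Qed.

Lemma bopB x y : a (x - y) = a x - a y.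
Proof. by rewrite bopD bopN. Qed.

Lemma bop_sum n (h : 'I_n -> H) : a (\sum_(i < n) h i) = \sum_(i < n) a (h i).
Proof. by apply: (big_morph a bopD bop0). Qed.

Lemma bop_cvg (u : nat -> H) (l : H) :
  u @ \oo --> l -> (fun n => a (u n)) @ \oo --> a l.
Proof.
have [M M0 hM] := bopP ba.
move=> /hcvgP ul; apply/hcvgP => e e0.
have [|n0 hn0] := ul (e / M); first by rewrite divr_gt0.
exists n0 => n /hn0; rewrite ltr_pdivlMr// mulrC -bopB => /(le_lt_trans _); apply.
exact: hM.
Qed.

End Linear.

Lemma bop_comp a b : bounded_ops H a -> bounded_ops H b -> bounded_ops H (a \o b).
Proof.
move=> ba bb; split=> [c x y|]; first by rewrite /= (bop_lin bb) (bop_lin ba).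
have [M M0 hM] := bopP ba; have [K K0 hK] := bopP bb.
exists (M * K) => x /=; rewrite (le_trans (hM _))// -mulrA ler_wpM2l//.
exact: ltW.
Qed.

Lemma bopDf a b : bounded_ops H a -> bounded_ops H b -> bounded_ops H (a + b).
Proof.
move=> ba bb; split=> [c x y|].
  by rewrite !fctE (bop_lin bb) (bop_lin ba) scalerDr addrACA.
have [M M0 hM] := bopP ba; have [K K0 hK] := bopP bb.
exists (M + K) => x; rewrite fctE (le_trans (hnorm_add _ _))// mulrDl lerD//.
Qed.

Lemma bopZf (c : R[i]) a : bounded_ops H a -> bounded_ops H (c *: a).
Proof.
move=> ba; split=> [d x y|].
  by rewrite !scalrfctE (bop_lin ba) scalerDr !scalerA mulrC.
have [M M0 hM] := bopP ba; exists (cnorm c * M) => x.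
by rewrite scalrfctE hnormZ -mulrA ler_wpM2l ?cnorm_ge0.
Qed.

Lemma bopNf a : bounded_ops H a -> bounded_ops H (- a).
Proof. by move=> /(@bopZf (-1)); rewrite scaleN1r. Qed.

Lemma bopBf a b : bounded_ops H a -> bounded_ops H b -> bounded_ops H (a - b).
Proof. by move=> ba /bopNf; exact: bopDf. Qed.

Lemma bop0f : bounded_ops H 0.
Proof.
split=> [c x y|]; first by rewrite /= scaler0 addr0.
by exists 0 => x; rewrite hnorm0 mul0r.
Qed.

Lemma bop_rank_one f e : bounded_ops H (rank_one f e).
Proof.
split=> [c x y|]; first by rewrite /rank_one linearDl/= dotZl scalerDl scalerA.
exists (hnorm e * hnorm f) => x; rewrite hnormZ mulrAC ler_wpM2r ?hnorm_ge0//.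
by rewrite mulrC cauchy_schwarz.
Qed.

Lemma opnorm_ub (a : H -> H) x : bounded_ops H a -> hnorm (a x) <= opnorm a * hnorm x.
Proof.
move=> ba; have [M M0 hM] := bopP ba.
have sup_ub y : hnorm y <= 1 -> hnorm (a y) <= opnorm a.
  move=> y1; apply: ub_le_sup; last by exists y.
  exists M => _ [z /= z1 <-]; rewrite (le_trans (hM z))//.
  by rewrite -[leRHS]mulr1 ler_wpM2l// ltW.
have [->|x0] := eqVneq x 0; first by rewrite (bop0 ba) hnorm0 mulr0.
have hx : 0 < hnorm x.
  by rewrite lt_neqAle hnorm_ge0 andbT eq_sym; apply: contra_neq x0 => /hnorm_eq0.
have := sup_ub (((hnorm x)^-1)%:C *: x).
rewrite (bopZ ba) !hnormZ cnormR ?invr_ge0 ?hnorm_ge0//.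
by rewrite mulVf ?gt_eqF// => /(_ (lexx _)); rewrite mulrC ler_pdivrMr.
Qed.

Lemma opnorm_le (a : H -> H) M : (forall x, hnorm (a x) <= M * hnorm x) -> 0 <= M ->
  opnorm a <= M.
Proof.
move=> hM M0; apply: ge_sup.
  by exists (hnorm (a 0)); exists 0 => //=; rewrite hnorm0.
move=> _ [x /= x1 <-]; rewrite (le_trans (hM x))//.
by rewrite -[leRHS]mulr1 ler_wpM2l.
Qed.

Lemma opnorm_ge0 (a : H -> H) : bounded_ops H a -> 0 <= opnorm a.
Proof.
move=> ba; have [M M0 hM] := bopP ba.
apply: (@le_trans _ _ (hnorm (a 0))); first exact: hnorm_ge0.
apply: ub_le_sup; last by exists 0 => //=; rewrite hnorm0.
exists M => _ [z /= z1 <-]; rewrite (le_trans (hM z))//.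
by rewrite -[leRHS]mulr1 ler_wpM2l// ltW.
Qed.

Definition contractive (a : H -> H) :=
  bounded_ops H a /\ forall x, hnorm (a x) <= hnorm x.

Lemma contractive_opnorm a : contractive a -> opnorm a <= 1.
Proof. by move=> [ba h]; apply: opnorm_le => // x; rewrite mul1r. Qed.

Lemma contractive_comp a b : contractive a -> contractive b -> contractive (a \o b).
Proof.
move=> [ba ha] [bb hb]; split; first exact: bop_comp.
by move=> x; rewrite (le_trans (ha _)) ?hb.
Qed.

Lemma contractive_id : contractive idfun.
Proof. by split => //; exact: bop_id. Qed.

(** * Adjoints *)

(** A relation, because the chosen function [adjoint] is meaningful only once
    some adjoint is known to exist; this is established in [adjointP]. *)
Definition adjoint_pair (a b : H -> H) :=
  [/\ bounded_ops H a, bounded_ops H b & forall x y, '[a x, y] = '[x, b y]].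

Lemma adjoint_pairE a b : adjoint_pair a b -> adjoint dot a = b.
Proof.
move=> [ba bb ab]; have [_ ab'] : [set b | bounded_ops H b /\
    forall x y, '[a x, y] = '[x, b y]] (adjoint dot a).
  by apply: xgetPex; exists b.
apply/funext => y; apply: dot_eqP => z.
by rewrite dotC -ab' ab -dotC.
Qed.

Lemma adjoint_pair_sym a b : adjoint_pair a b -> adjoint_pair b a.
Proof. by move=> [ba bb ab]; split=> // x y; rewrite dotC -ab -dotC. Qed.

Lemma adjoint_pair_comp a a' b b' : adjoint_pair a a' -> adjoint_pair b b' ->
  adjoint_pair (a \o b) (b' \o a').
Proof.
move=> [? ? aa'] [? ? bb']; split; [exact: bop_comp|exact: bop_comp|].
by move=> x y /=; rewrite aa' bb'.
Qed.

Lemma adjoint_pairD a a' b b' : adjoint_pair a a' -> adjoint_pair b b' ->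
  adjoint_pair (a + b) (a' + b').
Proof.
move=> [? ? aa'] [? ? bb']; split; [exact: bopDf|exact: bopDf|].
by move=> x y; rewrite !fctE linearDl linearDr/= aa' bb'.
Qed.

Lemma adjoint_pair_rank_one f e : adjoint_pair (rank_one f e) (rank_one e f).
Proof.
split; [exact: bop_rank_one|exact: bop_rank_one|] => x y.
by rewrite /rank_one dotZl dotZr -dotC mulrC.
Qed.

Lemma adjoint_pair_id : adjoint_pair idfun idfun.
Proof. by split => //; exact: bop_id. Qed.

(** * Orthogonal series *)

Section OrthogonalSeries.
Variable h : nat -> H.
Hypothesis orth : forall j k, j != k -> '[h j, h k] = 0.

Lemma hnorm_sum_orth m n : (m <= n)%N ->
  hnorm (\sum_(m <= k < n) h k) ^+ 2 = \sum_(m <= k < n) hnorm (h k) ^+ 2.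
Proof.
move=> mn; rewrite -(subnKC mn); elim: (n - m)%N => [|d IH].
  by rewrite addn0 !big_geq// hnorm0 expr0n.
rewrite addnS !big_nat_recr/= ?leq_addr// pythagoras ?IH//.
rewrite linear_sumlz/= big_nat; apply: big1 => k /andP[_ kn].
by rewrite orth// ltn_eqF.
Qed.

(** The squared norms of the partial sums form a bounded nondecreasing sequence
    of reals, and the squared norm of a block of the series is a difference of two
    of its terms. *)
Lemma riesz_fischer (B : R) :
  (forall n, \sum_(0 <= k < n) hnorm (h k) ^+ 2 <= B) ->
  exists l : H, (fun n => \sum_(0 <= k < n) h k) @ \oo --> l.
Proof.
move=> hB; pose s n : R := \sum_(0 <= k < n) hnorm (h k) ^+ 2.
have s_nd : nondecreasing_seq s.
  apply/nondecreasing_seqP => n; rewrite /s big_nat_recr//= lerDl sqr_ge0//.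
have s_ub n : s n <= sup (range s).
  by apply: ub_le_sup; [exists B => _ [k _ <-]; exact: hB|exists n].
apply: hcauchy_cvg => e e0.
have [_ [n0 _ <-] hn0] : exists2 r, range s r & sup (range s) - e ^+ 2 < r.
  apply: sup_gt; last by rewrite ltrBlDr ltrDl exprn_gt0.
  by exists (s 0%N), 0%N.
exists n0 => m n n0m mn.
rewrite -(@ltr_pXn2r _ 2) ?nnegrE ?hnorm_ge0 ?(ltW e0)//.
rewrite [X in hnorm (X - _)](@big_cat_nat _ _ _ m)//= addrAC subrr add0r.
rewrite hnorm_sum_orth//.
have -> : \sum_(m <= k < n) hnorm (h k) ^+ 2 = s n - s m.
  by rewrite /s [in RHS](@big_cat_nat _ _ _ m)//= addrAC subrr add0r.
rewrite ltrBlDr (le_lt_trans (s_ub n))// -ltrBlDl (lt_le_trans hn0)//.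
exact: s_nd.
Qed.

End OrthogonalSeries.

(** The shape in which Cauchy-Schwarz bounds a sum of squares [s] by itself: here
    [B] is the norm of a vector built from the terms of [s]. *)
Lemma sq_absorb (s A B : R) : 0 <= A -> 0 <= B -> s <= A * B -> B ^+ 2 <= s ->
  s <= A ^+ 2.
Proof.
move=> A0 B0 sAB Bs; have [AB|BA] := ltP A B; last first.
  by rewrite (le_trans sAB)// expr2 ler_wpM2l.
have : A * B < B ^+ 2 by rewrite expr2 ltr_pM2r// (le_lt_trans A0).
by move=> /(le_lt_trans sAB); rewrite ltNge Bs.
Qed.

(** Zero vectors are admitted, so that a family may be restricted to a subset of
    its indices and may come from dependent vectors. *)
Definition suborthonormal (f : nat -> H) :=
  (forall j k, j != k -> '[f j, f k] = 0) /\ forall k, hnorm (f k) <= 1.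

Definition partial_op (f g : nat -> H) (n : nat) (x : H) : H :=
  \sum_(0 <= k < n) '[x, g k] *: f k.

(** The series [sum_k f_k g_k^*]. Coordinate projections, the isometries of the
    Hilbert hotel and the partial isometry of the polar decomposition all have
    this form. *)
Definition series_op (f g : nat -> H) (x : H) : H :=
  lim (partial_op f g n x @[n --> \oo]).

Lemma bessel g n x : suborthonormal g ->
  \sum_(0 <= k < n) cnorm '[x, g k] ^+ 2 <= hnorm x ^+ 2.
Proof.
move=> [og g1]; set s := \sum_(_ <= _ < _) _.
have s0 : 0 <= s by apply: sumr_ge0 => k _; rewrite sqr_ge0.
pose y := partial_op g g n x.
have xy : '[x, y] = s%:C.
  rewrite /y linear_sumr rmorph_sum/=; apply: eq_bigr => k _.
  by rewrite dotZr mulrC mulJ_cnorm.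
have ys : hnorm y ^+ 2 <= s.
  rewrite hnorm_sum_orth//; first apply: ler_sum => k _.
    by rewrite hnormZ exprMn ler_piMr ?sqr_ge0// expr_le1// hnorm_ge0.
  by move=> j k jk; rewrite dotZl dotZr og// !mulr0.
have := cauchy_schwarz x y; rewrite xy cnormR// => sxy.
exact: (sq_absorb (hnorm_ge0 x) (hnorm_ge0 y) sxy ys).
Qed.

Section SeriesOp.
Variables f g : nat -> H.
Hypotheses (of_ : suborthonormal f) (og : suborthonormal g).

Lemma partial_op_orth x j k : j != k ->
  '['[x, g j] *: f j, '[x, g k] *: f k] = 0.
Proof. by move=> jk; rewrite dotZl dotZr of_.1// !mulr0. Qed.

Lemma partial_op_bound x n :
  \sum_(0 <= k < n) hnorm ('[x, g k] *: f k) ^+ 2 <= hnorm x ^+ 2.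
Proof.
apply: le_trans (bessel n x og); apply: ler_sum => k _.
by rewrite hnormZ exprMn ler_piMr ?sqr_ge0// expr_le1// ?hnorm_ge0// of_.2.
Qed.

Lemma series_op_cvg x : partial_op f g n x @[n --> \oo] --> series_op f g x.
Proof.
have [l hl] := riesz_fischer (@partial_op_orth x) (partial_op_bound x).
by rewrite /series_op (cvg_lim _ hl).
Qed.

Lemma bop_partial_op n : bounded_ops H (partial_op f g n).
Proof.
elim: n => [|n IH].
  rewrite (_ : partial_op f g 0 = 0); first exact: bop0f.
  by apply/funext => x; rewrite /partial_op big_geq.
rewrite (_ : partial_op f g n.+1 = partial_op f g n + rank_one (f n) (g n)).
  by apply: bopDf => //; exact: bop_rank_one.
by apply/funext => x; rewrite /partial_op big_nat_recr.
Qed.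

Lemma contractive_series_op : contractive (series_op f g).
Proof.
have bnd x : hnorm (series_op f g x) <= hnorm x.
  apply: (lim_hnorm_le (@series_op_cvg x)) => n.
  rewrite -(@ler_pXn2r _ 2) ?nnegrE ?hnorm_ge0//.
  rewrite hnorm_sum_orth// ?partial_op_bound// => j k; exact: partial_op_orth.
split => //; split; last by exists 1 => x; rewrite mul1r.
move=> c x y; apply: cvg_lim => //.
rewrite (_ : (fun n => _) =
    (fun n => c *: partial_op f g n x + partial_op f g n y)).
  by apply: cvgD; [apply: cvgZr|]; exact: series_op_cvg.
by apply/funext => n; rewrite (bop_lin (bop_partial_op n)).
Qed.

End SeriesOp.

Lemma partial_op_adj f g n x y :
  '[partial_op f g n x, y] = '[x, partial_op g f n y].
Proof.
rewrite linear_sumlz linear_sumr/=; apply: eq_bigr => k _.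
by rewrite dotZl dotZr -dotC mulrC.
Qed.

Lemma adjoint_pair_series_op f g : suborthonormal f -> suborthonormal g ->
  adjoint_pair (series_op f g) (series_op g f).
Proof.
move=> of_ og; split; [exact: (contractive_series_op of_ og).1|
  exact: (contractive_series_op og of_).1|] => x y.
apply: (lim_dot_eq (@series_op_cvg _ _ of_ og x) (@series_op_cvg _ _ og of_ y)) => n.
exact: partial_op_adj.
Qed.

Lemma series_op_at f g k : suborthonormal f -> suborthonormal g ->
  series_op f g (g k) = (hnorm (g k) ^+ 2)%:C *: f k.
Proof.
move=> of_ og; apply: cvg_lim => //; apply/hcvgP => e e0.
exists k.+1 => n kn; rewrite /partial_op.
rewrite (@big_cat_nat _ _ _ k)//= 1?ltnW// (@big_ltn _ _ _ k)//=.
rewrite big_nat big1 => [|j /andP[_ jk]]; last first.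
  by rewrite og.1 ?scale0r// gtn_eqF.
rewrite big_nat big1 => [|j /andP[kj _]]; last first.
  by rewrite og.1 ?scale0r// ltn_eqF.
by rewrite add0r addr0 dotxx subrr hnorm0.
Qed.

(** * Finite-rank projections *)

(** The rank is part of the predicate because the norm estimates in an ideal are
    proportional to it; adding one dimension at a time is the induction principle
    used for them. *)
Inductive finproj : nat -> (H -> H) -> Prop :=
| finproj0 : finproj 0 0
| finprojS n p e : finproj n p -> hnorm e = 1 -> p e = 0 ->
    finproj n.+1 (p + rank_one e e).

Lemma rank_oneE f e x : rank_one f e x = '[x, e] *: f. Proof. by []. Qed.

Lemma unit_dot e : hnorm e = 1 -> '[e, e] = 1.
Proof. by move=> e1; rewrite dotxx e1 expr1n. Qed.

Lemma finproj_adjoint n p : finproj n p -> adjoint_pair p p.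
Proof.
elim=> {n p} [|n p e _ IH _ _].
  by split; [exact: bop0f|exact: bop0f|] => x y /=; rewrite linear0l linear0r.
by apply: adjoint_pairD => //; exact: adjoint_pair_rank_one.
Qed.

Lemma finproj_idem n p : finproj n p -> forall x, p (p x) = p x.
Proof.
elim=> {n p} [|n p e fp IH e1 pe] x //=.
have [bp _ ap] := finproj_adjoint fp.
rewrite !fctE !rank_oneE (bopD bp) IH (bopZ bp) pe scaler0 addr0.
by rewrite linearDl/= ap pe linear0r add0r dotZl unit_dot// mulr1.
Qed.

Lemma finproj_bop n p : finproj n p -> bounded_ops H p.
Proof. by move=> /finproj_adjoint[]. Qed.

Lemma selfadj_idem_contractive p : adjoint_pair p p ->
  (forall x, p (p x) = p x) -> contractive p.
Proof.
move=> [bp _ ap] pp; split=> // x.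
have := dotxx (p x); rewrite -ap pp => h.
have := cauchy_schwarz (p x) x; rewrite h cnormR ?sqr_ge0// expr2.
have [->|px0] := eqVneq (hnorm (p x)) 0; first by rewrite hnorm_ge0.
by rewrite ler_pM2l// lt_neqAle eq_sym px0 hnorm_ge0.
Qed.

Lemma finproj_contractive n p : finproj n p -> contractive p.
Proof.
move=> fp; apply: selfadj_idem_contractive; first exact: finproj_adjoint fp.
exact: finproj_idem fp.
Qed.

Lemma contractiveC p n : finproj n p -> contractive (idfun - p).
Proof.
move=> fp; have [bp _ ap] := finproj_adjoint fp.
apply: selfadj_idem_contractive.
  split; [by apply: bopBf => //; exact: bop_id|by apply: bopBf => //; exact: bop_id|].
  by move=> x y; rewrite !fctE /= linearBl linearBr/= ap.
by move=> x; rewrite !fctE /= (bopB bp) (finproj_idem fp) subrr subr0.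
Qed.

(** One step of Gram-Schmidt. *)
Lemma finproj_extend1 n p d : finproj n p ->
  exists m q, [/\ finproj m q, forall x, q (p x) = p x & q d = d].
Proof.
move=> fp; have [bp _ ap] := finproj_adjoint fp.
have [dp|dp] := eqVneq (d - p d) 0.
  exists n, p; split => //; first exact: finproj_idem fp.
  by apply/esym/eqP; rewrite -subr_eq0; apply/eqP.
have nz : hnorm (d - p d) != 0 by apply: contra_neq dp => /hnorm_eq0.
pose e := ((hnorm (d - p d))^-1)%:C *: (d - p d).
have e1 : hnorm e = 1.
  by rewrite hnormZ cnormR ?invr_ge0 ?hnorm_ge0// mulVf.
have pe : p e = 0 by rewrite (bopZ bp) (bopB bp) (finproj_idem fp) subrr scaler0.
exists n.+1, (p + rank_one e e); split; first exact: finprojS.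
  by move=> x; rewrite !fctE rank_oneE (finproj_idem fp) ap pe linear0r scale0r addr0.
have de : d = p d + (hnorm (d - p d))%:C *: e.
  by rewrite scalerA -rmorphM/= mulfV// scale1r addrC subrK.
rewrite !fctE rank_oneE {2}de linearDl/= ap pe linear0r add0r dotZl unit_dot//.
by rewrite mulr1 -de.
Qed.

Lemma finproj_extend n p m (d : 'I_m -> H) : finproj n p ->
  exists k q, [/\ finproj k q, forall x, q (p x) = p x & forall i, q (d i) = d i].
Proof.
elim: m n p d => [|m IH] n p d fp.
  by exists n, p; split => //; [exact: finproj_idem fp|case].
have [k [q [fq qp qd]]] := IH n p (fun i => d (lift ord0 i)) fp.
have [l [r [fr rq rd]]] := finproj_extend1 (d ord0) fq.
exists l, r; split => // [x|i]; first by rewrite -qp rq.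
by have [j ->|->//] := unliftP ord0 i; rewrite -qd rq.
Qed.

Lemma finite_dim_finproj (A : set H) : finite_dim A ->
  exists n p, finproj n p /\ forall x, A x -> p x = x.
Proof.
move=> [m [d dA]]; have [n [p [fp _ pd]]] := finproj_extend d finproj0.
exists n, p; split=> // x /dA[c _ <-].
rewrite (bop_sum (finproj_bop fp)); apply: eq_bigr => i _.
by rewrite (bopZ (finproj_bop fp)) pd.
Qed.

Lemma finproj_finite_dim n p : finproj n p -> finite_dim (range p).
Proof.
move=> fp; suff [e he] : exists e : 'I_n -> H, forall x, exists c : 'I_n -> R[i],
    p x = \sum_(i < n) c i *: e i.
  by exists n, e => _ [x _ <-]; have [c ->] := he x; exists c.
elim: fp => {n p} [|n p e _ [f hf] _ _].
  by exists (fun=> 0) => x; exists (fun=> 0); rewrite big_ord0.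
exists (fun i => if unlift ord0 i is Some j then f j else e) => x.
have [c hc] := hf x.
exists (fun i => if unlift ord0 i is Some j then c j else '[x, e]).
rewrite big_ord_recl/= unlift_none addrC fctE hc; congr (_ + _).
by apply: eq_bigr => i _; rewrite liftK.
Qed.

Lemma countable_enum (T : Type) (x0 : T) (A : set T) : countable A ->
  exists d : nat -> T, forall x, A x -> exists k, d k = x.
Proof.
move=> /pfcard_geP[->|[d]]; first by exists (fun=> x0).
by exists d => x Ax; have [k _ <-] := 'surj_d Ax; exists k.
Qed.

Lemma separable_space_seq : separable_space H -> exists d : nat -> H,
  forall x (e : R), 0 < e -> exists k, hnorm (x - d k) < e.
Proof.
move=> [D cD dD]; have [d hd] := countable_enum 0 cD; exists d => x e e0.
have [|y []] := dD (ball x e%:C) _ (ball_open _ _).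
  by exists x; apply: ballxx; rewrite ltcR.
rewrite -ball_normE /= hnormE ltcR => xy /hd[k dk]; exists k.
by rewrite dk.
Qed.

(** * Orthonormal bases *)

Definition orthonormal_basis (e : nat -> H) :=
  (forall j k, '[e j, e k] = (j == k)%:R) /\
  forall x, partial_op e e n x @[n --> \oo] --> x.

Section BasisConstruction.
Hypothesis Hinf : ~ finite_dim [set: H].
Variable d : nat -> H.
Hypothesis hd : forall x (e : R), 0 < e -> exists k, hnorm (x - d k) < e.

(** The last condition puts [x] into the range of [p + e e^*]; asking only for a
    multiple of [e] allows the step to succeed when [x] is already in the range
    of [p]. *)
Definition next_vector (p : H -> H) (x : H) : H := xget 0
  [set e | [/\ hnorm e = 1, p e = 0 & exists c : R[i], x - p x = c *: e]].

Lemma next_vectorP n p x : finproj n p ->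
  [/\ hnorm (next_vector p x) = 1, p (next_vector p x) = 0 &
      exists c : R[i], x - p x = c *: next_vector p x].
Proof.
move=> fp; have bp := finproj_bop fp; pose Q := [set e | [/\ hnorm e = 1, p e = 0 &
  exists c : R[i], x - p x = c *: e]].
suff : exists e, Q e by move=> [e Qe]; exact: (xgetPex 0 (ex_intro _ e Qe)).
have normal z : z - p z != 0 ->
    let e := ((hnorm (z - p z))^-1)%:C *: (z - p z) in hnorm e = 1 /\ p e = 0.
  move=> zp /=; have nz : hnorm (z - p z) != 0 by apply: contra_neq zp => /hnorm_eq0.
  rewrite hnormZ cnormR ?invr_ge0 ?hnorm_ge0// mulVf//.
  by rewrite (bopZ bp) (bopB bp) (finproj_idem fp) subrr scaler0.
have [xp|xp] := eqVneq (x - p x) 0; last first.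
  have [e1 pe] := normal _ xp; exists (((hnorm (x - p x))^-1)%:C *: (x - p x)).
  split=> //; exists (hnorm (x - p x))%:C; rewrite scalerA -rmorphM/= mulfV ?scale1r//.
  by apply: contra_neq xp => /hnorm_eq0.
have [z zp] : exists z, z - p z != 0.
  apply: contrapT => h; apply: Hinf.
  have [n' [f hf]] := finproj_finite_dim fp; exists n', f => z _; apply: hf.
  exists z => //; apply/esym/eqP; rewrite -subr_eq0.
  by apply/negPn/negP => zp; apply: h; exists z.
have [e1 pe] := normal _ zp; exists (((hnorm (z - p z))^-1)%:C *: (z - p z)).
by split=> //; exists 0; rewrite xp scale0r.
Qed.

Fixpoint basis_proj n : H -> H :=
  if n is m.+1 then
    let e := next_vector (basis_proj m) (d m) in basis_proj m + rank_one e e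
  else 0.

Let e n := next_vector (basis_proj n) (d n).

Lemma finproj_basis_proj n : finproj n (basis_proj n).
Proof.
by elim: n => [|n IH]; [exact: finproj0|have [? ? _] := next_vectorP (d n) IH; exact: finprojS].
Qed.

Let eP n := next_vectorP (d n) (finproj_basis_proj n).

Lemma basis_projS n x : basis_proj n.+1 x = basis_proj n x + '[x, e n] *: e n.
Proof. by []. Qed.

Lemma basis_proj_mono m n x : (m <= n)%N -> basis_proj m x = x -> basis_proj n x = x.
Proof.
move=> mn mx; rewrite -(subnKC mn); elim: (n - m)%N => [|k IH]; first by rewrite addn0.
have [_ pe _] := eP (m + k)%N; have [_ _ ap] := finproj_adjoint (finproj_basis_proj (m + k)).
rewrite addnS basis_projS IH (_ : '[x, _] = 0) ?scale0r ?addr0//.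
by rewrite -IH ap pe linear0r.
Qed.

Lemma basis_proj_vector n : basis_proj n.+1 (e n) = e n.
Proof.
have [e1 pe _] := eP n.
by rewrite basis_projS pe add0r unit_dot// scale1r.
Qed.

Lemma basis_proj_dense n : basis_proj n.+1 (d n) = d n.
Proof.
have [e1 pe [c hc]] := eP n; have := hc => /(canRL (subrK _)) ->.
have bp := finproj_bop (finproj_basis_proj n.+1).
rewrite (bopD bp) (bopZ bp) basis_proj_vector; congr (_ + _).
apply: (basis_proj_mono (leqnSn n)).
exact: (finproj_idem (finproj_basis_proj n)).
Qed.

(** The [n]-th projection fixes [d k] for all [k < n] and is contractive, so its
    values converge on the closure of the [d k]. *)
Lemma orthonormal_basis_construction : orthonormal_basis e.
Proof.
have orth j k : (j < k)%N -> '[e k, e j] = 0.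
  move=> jk; have [_ pe _] := eP k.
  have [_ _ ap] := finproj_adjoint (finproj_basis_proj k).
  rewrite -(basis_proj_mono jk (basis_proj_vector j)) -ap pe linear0l//.
split=> [j k|x].
  have [jk|jk|<-] := ltngtP j k; last by rewrite unit_dot//; have [] := eP j.
    by rewrite dotC orth// rmorph0.
  by rewrite orth.
apply/hcvgP => r r0; have r2 : 0 < r / 2 by rewrite divr_gt0.
have [k hk] := hd x r2; exists k.+1 => n kn.
have -> : partial_op e e n x = basis_proj n x.
  elim: {kn} n => [|n IH]; first by rewrite /partial_op big_geq.
  by rewrite basis_projS -IH /partial_op big_nat_recr.
have bp := finproj_contractive (finproj_basis_proj n).
rewrite (le_lt_trans (hnorm_trans (d k) _ _))// [ltRHS]splitr.
rewrite (_ : d k - x = - (x - d k)); last by rewrite opprB.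
rewrite hnorm_opp -{1}(basis_proj_mono kn (basis_proj_dense k)) -(bopB bp.1).
by rewrite ltrD// (le_lt_trans (bp.2 _))// hdistC.
Qed.

End BasisConstruction.

Lemma orthonormal_basis_exists : separable_space H -> ~ finite_dim [set: H] ->
  exists e, orthonormal_basis e.
Proof.
move=> /separable_space_seq[d hd] Hinf; eexists.
exact: (orthonormal_basis_construction Hinf hd).
Qed.

(** * Operators described by a basis *)

Section Basis.
Variable e : nat -> H.
Hypothesis he : orthonormal_basis e.

Lemma basis_norm k : hnorm (e k) = 1.
Proof.
have : (hnorm (e k) ^+ 2)%:C = 1%:C by rewrite -dotxx he.1 eqxx.
move=> /complexI/eqP; rewrite sqrf_eq1 => /orP[|] /eqP // h.
by have := hnorm_ge0 (e k); rewrite h ler0N1.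
Qed.

Lemma basis_ext (a b : H -> H) : bounded_ops H a -> bounded_ops H b ->
  (forall k, a (e k) = b (e k)) -> a = b.
Proof.
move=> ba bb ab; apply/funext => x.
have ha := bop_cvg ba (he.2 x); have hb := bop_cvg bb (he.2 x).
suff hE : (fun n => a (partial_op e e n x)) = (fun n => b (partial_op e e n x)).
  by rewrite hE in ha; exact: cvg_unique ha hb.
apply/funext => n; rewrite /partial_op !big_mkord (bop_sum ba) (bop_sum bb).
by apply: eq_bigr => k _; rewrite (bopZ ba) (bopZ bb) ab.
Qed.

(** The adjoint is [y |-> sum_k <y, a e_k> e_k]. A partial sum [z] satisfies
    [|z|^2 = <y, a z> <= M |y| |z|], which bounds the series. *)
Lemma adjointP (a : H -> H) : bounded_ops H a -> adjoint_pair a (adjoint dot a).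
Proof.
move=> ba; suff [b hb] : exists b, adjoint_pair a b by rewrite (adjoint_pairE hb).
have [M M0 hM] := bopP ba.
pose h y k := '[y, a (e k)] *: e k.
have orth y j k : j != k -> '[h y j, h y k] = 0.
  by move=> /negPf jk; rewrite dotZl dotZr he.1 jk !mulr0.
have bnd y n : \sum_(0 <= k < n) hnorm (h y k) ^+ 2 <= (M * hnorm y) ^+ 2.
  pose z := \sum_(0 <= k < n) h y k.
  have zE : hnorm z ^+ 2 = \sum_(0 <= k < n) hnorm (h y k) ^+ 2.
    by rewrite (hnorm_sum_orth (orth y)).
  have yz : '[y, a z] = (hnorm z ^+ 2)%:C.
    rewrite zE rmorph_sum /z big_mkord (bop_sum ba) linear_sumr/= big_mkord.
    apply: eq_bigr => k _; rewrite (bopZ ba) dotZr mulrC mulJ_cnorm.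
    by rewrite hnormZ basis_norm mulr1.
  have := cauchy_schwarz y (a z); rewrite yz cnormR ?sqr_ge0// -zE => le1.
  apply: (sq_absorb _ (hnorm_ge0 z) _ (lexx _)).
    by rewrite mulr_ge0 ?hnorm_ge0// ltW.
  by rewrite (le_trans le1)// [M * _]mulrC -mulrA ler_wpM2l// hnorm_ge0.
have /(_ _)/cid-/all_sig[b hb] :=
  fun y => riesz_fischer (orth y) (bnd y).
have ab x y : '[a x, y] = '[x, b y].
  apply: (lim_dot_eq (bop_cvg ba (he.2 x)) (hb y)) => n.
  rewrite /partial_op !big_mkord (bop_sum ba) linear_sumlz linear_sumr/=.
  by apply: eq_bigr => k _; rewrite (bopZ ba) dotZl dotZr -dotC mulrC.
exists b; split=> //; split.
  move=> c x y; apply: dot_eqP => z; rewrite linearDl/= dotZl.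
  rewrite [LHS]dotC [ '[b x, _] ]dotC [ '[b y, _] ]dotC -!ab linearDr/= dotZr.
  by rewrite rmorphD rmorphM/= conjCK.
exists M => y; apply: (lim_hnorm_le (hb y)) => n.
rewrite -(@ler_pXn2r _ 2) ?nnegrE ?mulr_ge0 ?hnorm_ge0 ?(ltW M0)//.
by rewrite (hnorm_sum_orth (orth y)).
Qed.

Lemma series_op_orth (f g : nat -> H) x : (forall k, '[x, g k] = 0) ->
  series_op f g x = 0.
Proof.
move=> xg; apply: cvg_lim => //; apply/hcvgP => r r0; exists 0%N => n _.
rewrite /partial_op big1 ?subrr ?hnorm0// => k _.
by rewrite xg scale0r.
Qed.

Lemma basis_sub_suborth (sigma : nat -> nat) : injective sigma ->
  suborthonormal (e \o sigma).
Proof.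
move=> si; split=> [j k jk|k] /=; last by rewrite basis_norm.
by rewrite he.1 (inj_eq si) (negPf jk).
Qed.

Definition basis_part (S : nat -> bool) : nat -> H := fun k => if S k then e k else 0.

Lemma basis_part_suborth S : suborthonormal (basis_part S).
Proof.
rewrite /basis_part; split=> [j k jk|k].
  by do 2![case: ifP => _; rewrite ?linear0l ?linear0r//]; rewrite he.1 (negPf jk).
by case: ifP => _; rewrite ?basis_norm// hnorm0.
Qed.

(** The orthogonal projection onto the closed span of the [e k] with [S k]. *)
Definition coord_proj S := series_op (basis_part S) (basis_part S).

Lemma coord_proj_contractive S : contractive (coord_proj S).
Proof. by apply: contractive_series_op; exact: basis_part_suborth. Qed.

Lemma coord_proj_bop S : bounded_ops H (coord_proj S).
Proof. exact: (coord_proj_contractive S).1. Qed.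

Lemma coord_projE S k : coord_proj S (e k) = if S k then e k else 0.
Proof.
have [Sk|Sk] := boolP (S k).
  have := series_op_at k (basis_part_suborth S) (basis_part_suborth S).
  by rewrite /basis_part Sk basis_norm expr1n scale1r.
apply: series_op_orth => j; rewrite /basis_part; case: ifP => Sj; last exact: linear0r.
rewrite he.1; case: eqP => // kj; by rewrite kj Sj in Sk.
Qed.

Lemma coord_projI S T :
  coord_proj S \o coord_proj T = coord_proj (fun k => S k && T k).
Proof.
apply: basis_ext; [by apply: bop_comp; exact: coord_proj_bop|exact: coord_proj_bop|].
move=> k /=; rewrite !coord_projE; case: (T k); rewrite ?andbF ?andbT ?coord_projE//.
exact: (bop0 (coord_proj_bop S)).
Qed.

Lemma coord_proj_split (S T : nat -> bool) : (forall k, T k -> S k) ->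
  coord_proj S = coord_proj T + coord_proj (fun k => S k && ~~ T k).
Proof.
move=> TS; apply: basis_ext; [exact: coord_proj_bop|
  by apply: bopDf; exact: coord_proj_bop|].
move=> k /=; rewrite fctE !coord_projE.
by have [/TS ->|] := boolP (T k); rewrite ?andbF ?andbT ?addr0 ?add0r.
Qed.

Lemma coord_proj_ltn n : coord_proj (fun k => (k < n)%N) = partial_op e e n.
Proof.
apply: basis_ext; [exact: coord_proj_bop|exact: bop_partial_op|].
move=> k; rewrite coord_projE /partial_op; have [kn|kn] := ltnP k n.
  rewrite (@big_cat_nat _ _ _ k)//= 1?ltnW// (@big_ltn _ _ _ k)//=.
  rewrite big_nat big1 => [|j /andP[_ jk]]; last by rewrite he.1 gtn_eqF// scale0r.
  rewrite big_nat big1 => [|j /andP[kj _]]; last by rewrite he.1 ltn_eqF// scale0r.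
  by rewrite he.1 eqxx scale1r add0r addr0.
rewrite big_nat big1// => j /andP[_ jn].
by rewrite he.1 gtn_eqF ?scale0r// (leq_trans jn).
Qed.

Lemma finproj_partial_op n : finproj n (partial_op e e n).
Proof.
elim: n => [|n IH].
  rewrite (_ : partial_op e e 0 = 0); first exact: finproj0.
  by apply/funext => x; rewrite /partial_op big_geq.
rewrite (_ : partial_op e e n.+1 = partial_op e e n + rank_one (e n) (e n)).
  apply: finprojS => //; first exact: basis_norm.
  by rewrite -coord_proj_ltn coord_projE ltnn.
by apply/funext => x; rewrite /partial_op big_nat_recr.
Qed.

(** The basis is split into its even and its odd part, each being as large as
    the whole. *)
Lemma hilbert_hotel : exists s s' t t' : H -> H,
  [/\ adjoint_pair s s', adjoint_pair t t', s' \o s = idfun, t' \o t = idfun &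
      [/\ s' \o t = 0, t' \o s = 0 & (s \o s') + (t \o t') = idfun]].
Proof.
pose dbl := double; pose dbS k := (k.*2).+1.
have od : suborthonormal (e \o dbl) := basis_sub_suborth double_inj.
have oS : suborthonormal (e \o dbS).
  by apply: basis_sub_suborth => j k [/double_inj].
have oe : suborthonormal e by have := @basis_sub_suborth id (fun _ _ h => h).
pose s := series_op (e \o dbl) e; pose s' := series_op e (e \o dbl).
pose t := series_op (e \o dbS) e; pose t' := series_op e (e \o dbS).
have as_ : adjoint_pair s s' by exact: adjoint_pair_series_op.
have at_ : adjoint_pair t t' by exact: adjoint_pair_series_op.
have [bs bs' _] := as_; have [bt bt' _] := at_.
have sE k : s (e k) = e k.*2.
  by rewrite /s (series_op_at k od oe) basis_norm expr1n scale1r.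
have tE k : t (e k) = e (k.*2).+1.
  by rewrite /t (series_op_at k oS oe) basis_norm expr1n scale1r.
have s'E k : s' (e k.*2) = e k.
  by rewrite /s' -[e k.*2]/((e \o dbl) k) (series_op_at k oe od) basis_norm expr1n scale1r.
have t'E k : t' (e (k.*2).+1) = e k.
  by rewrite /t' -[e (k.*2).+1]/((e \o dbS) k) (series_op_at k oe oS) basis_norm expr1n scale1r.
have s'0 k : s' (e (k.*2).+1) = 0.
  apply: series_op_orth => j /=; rewrite he.1; case: eqP => // /(congr1 odd).
  by rewrite /= !odd_double.
have t'0 k : t' (e k.*2) = 0.
  apply: series_op_orth => j /=; rewrite he.1; case: eqP => // /(congr1 odd).
  by rewrite /= !odd_double.
exists s, s', t, t'; split=> //.
- apply: basis_ext => [||k]; [exact: bop_comp|exact: bop_id|by rewrite /= sE s'E].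
- apply: basis_ext => [||k]; [exact: bop_comp|exact: bop_id|by rewrite /= tE t'E].
- split.
  + apply: basis_ext => [||k]; [exact: bop_comp|exact: bop0f|by rewrite /= tE s'0].
  + apply: basis_ext => [||k]; [exact: bop_comp|exact: bop0f|by rewrite /= sE t'0].
  + apply: basis_ext => [||k]; [|exact: bop_id|].
      by apply: bopDf; exact: bop_comp.
    rewrite fctE /= -(odd_double_half k); case: (odd k); rewrite ?add0n ?add1n.
      by rewrite s'0 t'E tE (bop0 bs) add0r.
    by rewrite s'E t'0 sE (bop0 bt) addr0.
Qed.

End Basis.

(** * Polar decomposition *)

(** Polarisation: the quadratic form at [x + y] and at [x + i y] recovers
    [<a x, y>]. *)
Lemma quadratic_form_eq0 (a : H -> H) : bounded_ops H a ->
  (forall x, '[a x, x] = 0) -> a = 0.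
Proof.
move=> ba ha; apply/funext => x; apply: dot_eqP => y; rewrite linear0l.
have sym u v : '[a u, v] + '[a v, u] = 0.
  have := ha (u + v); rewrite (bopD ba) linearDl/= !linearDr/= !ha.
  by rewrite add0r addr0.
have h1 := sym x y; have := sym x (('i%R : R[i]) *: y).
rewrite (bopZ ba) dotZl dotZr.
have -> : Num.conj ('i%R : R[i]) = - 'i%R by exact: conjCi.
rewrite mulNr addrC -mulrBr => /eqP; rewrite mulf_eq0 (negPf (neq0Ci _))/= subr_eq0 => /eqP h2.
move: h1; rewrite h2 -mulr2n => /eqP; rewrite mulrn_eq0/= => /eqP//.
Qed.

Lemma positive_selfadj a b : adjoint_pair a b -> positive_op dot a -> a = b.
Proof.
move=> [ba bb ab] [_ pa]; apply/eqP; rewrite -subr_eq0; apply/eqP.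
apply: quadratic_form_eq0 => [|x]; first exact: bopBf.
have -> : (a - b) x = a x - b x by [].
rewrite linearBl/= [ '[b x, x] ]dotC -ab.
by rewrite (CrealP (ger0_real (pa x))) subrr.
Qed.

Lemma adjoint_contractive a b : adjoint_pair a b -> contractive a -> contractive b.
Proof.
move=> [_ bb ab] [_ a1]; split=> // u.
have [->|nz] := eqVneq (hnorm (b u)) 0; first exact: hnorm_ge0.
have := cauchy_schwarz (a (b u)) u; rewrite ab dotxx cnormR ?sqr_ge0// => h.
have : hnorm (b u) ^+ 2 <= hnorm (b u) * hnorm u.
  by rewrite (le_trans h)// ler_wpM2r ?hnorm_ge0.
by rewrite expr2 ler_pM2l// lt_neqAle eq_sym nz hnorm_ge0.
Qed.

Section Douglas.
Variable e : nat -> H.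
Hypothesis he : orthonormal_basis e.
Variables a b : H -> H.
Hypotheses (ba : bounded_ops H a) (bb : bounded_ops H b).
Hypothesis ab : forall x, hnorm (a x) = hnorm (b x).

Lemma isometric_dot x y : '[a x, a y] = '[b x, b y].
Proof.
have [_ ba' haa] := adjointP he ba; have [_ bb' hbb] := adjointP he bb.
have : (adjoint dot a \o a) - (adjoint dot b \o b) = 0.
  apply: quadratic_form_eq0 => [|z]; first by apply: bopBf; exact: bop_comp.
  rewrite (_ : _ z = adjoint dot a (a z) - adjoint dot b (b z))// linearBl/=.
  rewrite [X in X - _]dotC [X in _ - X]dotC -haa -hbb -!dotC !dotxx ab subrr//.
move=> /(congr1 (fun f => f y)) /= /eqP; rewrite subr_eq0 => /eqP h.
by rewrite haa hbb; congr ('[_, _]); exact: h.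
Qed.

(** Gram-Schmidt applied to the vectors [b (e n)] but recorded on the arguments of
    [b]: the vectors [b (xi n)] are orthogonal of norm 0 or 1, and [b (gs n x)] is
    the projection of [b x] onto the span of the first [n] of them. *)
Definition gs_residue (q : H -> H) n : H := e n - q (e n).
Definition gs_vector (q : H -> H) n : H :=
  ((hnorm (b (gs_residue q n)))^-1)%:C *: gs_residue q n.
Fixpoint gs n : H -> H :=
  if n is m.+1 then
    fun x => gs m x + '[b x, b (gs_vector (gs m) m)] *: gs_vector (gs m) m
  else 0.
Let xi n := gs_vector (gs n) n.

Lemma gsS n x : gs n.+1 x = gs n x + '[b x, b (xi n)] *: xi n.
Proof. by []. Qed.

Lemma gs_vector_norm n : b (xi n) = 0 \/ hnorm (b (xi n)) = 1.
Proof.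
rewrite /xi /gs_vector (bopZ bb) hnormZ cnormR ?invr_ge0 ?hnorm_ge0//.
have [->|h] := eqVneq (hnorm (b (gs_residue (gs n) n))) 0.
  by left; rewrite invr0 scale0r.
by right; rewrite mulVf.
Qed.

Lemma gs_selfadj n x y : '[b (gs n x), b y] = '[b x, b (gs n y)].
Proof.
elim: n => [|n IH]; first by rewrite /= (bop0 bb) linear0l linear0r.
rewrite !gsS; move: (xi n) => w.
rewrite !(bopD bb) !(bopZ bb) linearDl linearDr/= IH dotZl dotZr.
by rewrite -dotC [X in _ + X]mulrC.
Qed.

Lemma gs_fix n : (forall j, (j < n)%N -> b (gs n (xi j)) = b (xi j)) /\
  forall j, (j < n)%N -> '[b (xi n), b (xi j)] = 0.
Proof.
have orth n' : (forall j, (j < n')%N -> b (gs n' (xi j)) = b (xi j)) ->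
    forall j, (j < n')%N -> '[b (xi n'), b (xi j)] = 0.
  move=> fix_ j /fix_; move: (xi j) => w bw.
  rewrite /xi /gs_vector (bopZ bb) dotZl /gs_residue (bopB bb).
  by rewrite linearBl/= gs_selfadj bw subrr mulr0.
suff fix_ : forall j, (j < n)%N -> b (gs n (xi j)) = b (xi j) by split=> //; exact: orth.
elim: n => // n IH j; rewrite ltnS leq_eqVlt gsS (bopD bb) (bopZ bb) => /predU1P[->|jn].
  have -> : b (gs n (xi n)) = 0.
    apply: hnorm_eq0; apply/eqP; rewrite -sqrf_eq0; apply/eqP/complexI.
    rewrite -dotxx gs_selfadj.
    have : forall z, '[b (xi n), b (gs n z)] = 0.
      have := orth _ IH; move: (xi n) => w ow z.
      have : forall m, (m <= n)%N -> '[b w, b (gs m z)] = 0.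
        elim=> [_|m IHm mn]; first by rewrite /= (bop0 bb) linear0r.
        rewrite gsS (bopD bb) (bopZ bb) linearDr/= IHm 1?ltnW// dotZr ow//.
        by rewrite mulr0 addr0.
      exact.
    exact.
  have [->|h] := gs_vector_norm n; first by rewrite linear0r scale0r addr0.
  by rewrite unit_dot// scale1r add0r.
rewrite IH// [ '[b (xi j), _] ]dotC orth// rmorph0 scale0r addr0//.
Qed.

Lemma gs_orth j k : j != k -> '[b (xi j), b (xi k)] = 0.
Proof.
rewrite neq_ltn => /orP[|] jk; last exact: (gs_fix j).2.
by rewrite dotC (gs_fix k).2// rmorph0.
Qed.

(** By polarisation the vectors [a (xi k)] are orthogonal like the [b (xi k)], so
    [c = sum_k (a xi_k) (b xi_k)^*] is bounded. It sends [b (xi k)] to [a (xi k)],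
    hence [b x] to [a x] for the basis vectors [x], which differ from combinations
    of the [xi k] by vectors that [a] and [b] annihilate. *)
Lemma isometric_factor : exists2 c, bounded_ops H c & a = c \o b.
Proof.
pose f k := a (xi k); pose g k := b (xi k).
have n1 k : hnorm (b (xi k)) <= 1.
  by have [->|->] := gs_vector_norm k; rewrite ?hnorm0.
have og : suborthonormal g by split=> [j k|//]; exact: gs_orth.
have of_ : suborthonormal f.
  by split=> [j k jk|k]; rewrite /f ?isometric_dot ?gs_orth// ab.
pose c := series_op f g.
have bc : bounded_ops H c by exact: (contractive_series_op of_ og).1.
have cxi k : c (b (xi k)) = a (xi k).
  rewrite /c (series_op_at k of_ og); rewrite /g.
  have [h|->] := gs_vector_norm k; last by rewrite expr1n scale1r.
  rewrite h hnorm0 expr0n scale0r.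
  by apply/esym/hnorm_eq0; rewrite ab h hnorm0.
exists c => //; apply: (basis_ext he) => [//||k]; first exact: bop_comp.
have -> : e k = gs k (e k) + gs_residue (gs k) k by rewrite /gs_residue addrC subrK.
have cgs n z : a (gs n z) = c (b (gs n z)).
  elim: n => [|n IH]; first by rewrite /= (bop0 bb) (bop0 ba) (bop0 bc).
  rewrite gsS; have := cxi n; move: (xi n) => w cw.
  by rewrite !(bopD bb, bopD ba, bopD bc) !(bopZ bb, bopZ ba, bopZ bc) cw IH.
rewrite /= (bopD ba) (bopD bb) (bopD bc) cgs; congr (_ + _).
set z := gs_residue _ _.
have [bz|bz] := eqVneq (hnorm (b z)) 0.
  rewrite (hnorm_eq0 bz) (bop0 bc); apply: hnorm_eq0; by rewrite ab.
have -> : z = (hnorm (b z))%:C *: xi k.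
  by rewrite /xi /gs_vector scalerA -rmorphM/= mulfV// scale1r.
have := cxi k; move: (xi k) => w cw.
by rewrite (bopZ bb) (bopZ bc) (bopZ ba) cw.
Qed.

End Douglas.

Section SquareRoot.
Variables t : H -> H.
Hypotheses (at_ : adjoint_pair t t) (t1 : forall x, hnorm (t x) <= hnorm x).

(** The square root of [1 - t] is [1 - y], where [y] is the fixed point of
    [y |-> (t + y^2) / 2]. *)
Fixpoint sqrt_iter n : H -> H :=
  if n is m.+1 then (2^-1 : R)%:C *: (t + (sqrt_iter m \o sqrt_iter m)) else 0.
(** The same iteration for the number 1 in place of [t]. It increases and stays
    below 1, and its increments dominate those of [sqrt_iter], so the latter
    converges in norm. *)
Fixpoint sqrt_maj n : R := if n is m.+1 then (1 + sqrt_maj m ^+ 2) / 2 else 0.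

Lemma sqrt_maj_bounds n : 0 <= sqrt_maj n <= 1.
Proof.
by elim: n => [|n /andP[h0 h1]] /=; [rewrite lexx ler01|apply/andP; split; nra].
Qed.

Lemma sqrt_maj_nd : nondecreasing_seq sqrt_maj.
Proof.
by apply/nondecreasing_seqP => n; have /andP[h0 h1] := sqrt_maj_bounds n => /=; nra.
Qed.

Lemma sqrt_iter_adj n : adjoint_pair (sqrt_iter n) (sqrt_iter n).
Proof.
elim: n => [|n IH] /=.
  by split; [exact: bop0f|exact: bop0f|] => x y /=; rewrite linear0l linear0r.
have [bt _ tt] := adjoint_pairD at_ (adjoint_pair_comp IH IH).
split; [exact: bopZf|exact: bopZf|] => x y.
by rewrite !scalrfctE dotZl dotZr tt conj_realC.
Qed.

Lemma sqrt_iterS n x :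
  sqrt_iter n.+1 x = (2^-1 : R)%:C *: (t x + sqrt_iter n (sqrt_iter n x)).
Proof. by []. Qed.

Lemma sqrt_iter_le n x : hnorm (sqrt_iter n x) <= sqrt_maj n * hnorm x.
Proof.
elim: n x => [|n IH] x; first by rewrite /= hnorm0 mul0r.
have /andP[r0 r1] := sqrt_maj_bounds n.
rewrite sqrt_iterS hnormZ cnormR ?invr_ge0//= mulrC -[leRHS]mulrA [_ * hnorm x]mulrC mulrA.
rewrite ler_pM2r ?invr_gt0// (le_trans (hnorm_add _ _))// mulrDl mul1r lerD//.
by rewrite (le_trans (IH _))// expr2 -mulrA ler_wpM2l.
Qed.

Lemma sqrt_iter_diff n x : hnorm (sqrt_iter n.+1 x - sqrt_iter n x) <=
  (sqrt_maj n.+1 - sqrt_maj n) * hnorm x.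
Proof.
elim: n x => [|n IH] x.
  rewrite sqrt_iterS /= (_ : (0 : H -> H) _ = 0)// addr0 !subr0 hnormZ cnormR ?invr_ge0//.
  by rewrite expr0n addr0 mul1r ler_wpM2l// invr_ge0.
have [bn _ _] := sqrt_iter_adj n; have [bn1 _ _] := sqrt_iter_adj n.+1.
set y := sqrt_iter n; set y1 := sqrt_iter n.+1.
have -> : sqrt_iter n.+2 x - y1 x =
    (2^-1 : R)%:C *: (y1 (y1 x - y x) + (y1 (y x) - y (y x))).
  have e2 : sqrt_iter n.+2 x = (2^-1 : R)%:C *: (t x + y1 (y1 x)) by [].
  have e1 : y1 x = (2^-1 : R)%:C *: (t x + y (y x)) by [].
  rewrite e2 [X in _ - X = _]e1 -scalerBr; congr (_ *: _).
  have -> : y1 (y1 x - y x) = y1 (y1 x) - y1 (y x) by exact: (bopB bn1).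
  by rewrite subrKA opprD addrACA subrr add0r.
have /andP[r0 r1] := sqrt_maj_bounds n; have /andP[s0 s1] := sqrt_maj_bounds n.+1.
have d0 : 0 <= sqrt_maj n.+1 - sqrt_maj n by rewrite subr_ge0 sqrt_maj_nd.
have x0 := hnorm_ge0 x.
rewrite hnormZ cnormR ?invr_ge0//.
have h1 : hnorm (y1 (y1 x - y x)) <= sqrt_maj n.+1 * ((sqrt_maj n.+1 - sqrt_maj n) * hnorm x).
  by rewrite (le_trans (sqrt_iter_le _ _))// ler_wpM2l.
have h2 : hnorm (y1 (y x) - y (y x)) <= (sqrt_maj n.+1 - sqrt_maj n) * (sqrt_maj n * hnorm x).
  by rewrite (le_trans (IH _))// ler_wpM2l// sqrt_iter_le.
have h3 := hnorm_add (y1 (y1 x - y x)) (y1 (y x) - y (y x)).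
rewrite (_ : sqrt_maj n.+2 = (1 + sqrt_maj n.+1 ^+ 2) / 2)//.
rewrite {2}(_ : sqrt_maj n.+1 = (1 + sqrt_maj n ^+ 2) / 2)//.
rewrite mulrC ler_pdivrMr//; apply: (le_trans h3); apply: (le_trans (lerD h1 h2)).
by rewrite le_eqVlt; apply/orP; left; apply/eqP; field.
Qed.

Lemma sqrt_iter_cauchy m n x : (m <= n)%N ->
  hnorm (sqrt_iter n x - sqrt_iter m x) <= (sqrt_maj n - sqrt_maj m) * hnorm x.
Proof.
move=> mn; rewrite -(subnKC mn); elim: (n - m)%N => [|k IH].
  by rewrite addn0 !subrr hnorm0 mul0r.
rewrite addnS (le_trans (hnorm_trans (sqrt_iter (m + k) x) _ _))//.
rewrite -(subrKA (sqrt_maj (m + k)) (sqrt_maj _) (- _)) mulrDl lerD//.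
exact: sqrt_iter_diff.
Qed.

Lemma sqrt_iter_cvg : exists y : H -> H, forall x, sqrt_iter n x @[n --> \oo] --> y x.
Proof.
suff /(_ _)/cid-/all_sig[y hy] : forall x, exists l : H, sqrt_iter n x @[n --> \oo] --> l.
  by exists y.
move=> x; apply: hcauchy_cvg => r r0.
have rub : has_sup (range sqrt_maj).
  split; first by exists (sqrt_maj 0), 0%N.
  by exists 1 => _ [n _ <-]; have /andP[] := sqrt_maj_bounds n.
have x1 : 0 < hnorm x + 1 by rewrite ltr_wpDl ?hnorm_ge0.
have [_ [n0 _ <-] hn0] : exists2 s, range sqrt_maj s &
    sup (range sqrt_maj) - r / (hnorm x + 1) < s.
  by apply: sup_gt; [exact: rub.1|rewrite ltrBlDr ltrDl divr_gt0].
exists n0 => m n n0m mn; rewrite (le_lt_trans (sqrt_iter_cauchy _ mn))//.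
have d0 : 0 <= sqrt_maj n - sqrt_maj m by rewrite subr_ge0 sqrt_maj_nd.
apply: (@le_lt_trans _ _ ((sqrt_maj n - sqrt_maj m) * (hnorm x + 1))).
  by rewrite ler_wpM2l// lerDl.
rewrite -ltr_pdivlMr//.
have h1 : sqrt_maj n <= sup (range sqrt_maj) by apply: ub_le_sup; [exact: rub.2|exists n].
have h2 := sqrt_maj_nd n0m.
by rewrite ltrBlDr (le_lt_trans h1)// -ltrBlDl (lt_le_trans hn0).
Qed.

Lemma sqrt_exists : exists s : H -> H,
  [/\ adjoint_pair s s, positive_op dot s & forall x, s (s x) = x - t x].
Proof.
have [y hy] := sqrt_iter_cvg.
have adj n := sqrt_iter_adj n.
have le1 n x : hnorm (sqrt_iter n x) <= hnorm x.
  have /andP[r0 r1] := sqrt_maj_bounds n.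
  by rewrite (le_trans (sqrt_iter_le _ _))// ler_piMl ?hnorm_ge0.
have ay u v : '[y u, v] = '[u, y v].
  by apply: (lim_dot_eq (@hy u) (@hy v)) => n; have [_ _ ->] := adj n.
have y1 x : hnorm (y x) <= hnorm x by apply: (lim_hnorm_le (@hy x)).
have by_ : bounded_ops H y.
  split; last by exists 1 => x; rewrite mul1r.
  move=> c u v; apply: dot_eqP => z.
  by rewrite ay linearDl/= dotZl -!ay linearDl/= dotZl.
have yy x : 2%:R *: y x = t x + y (y x).
  have h1 : (fun n => t x + sqrt_iter n (sqrt_iter n x)) @ \oo --> t x + y (y x).
    apply: cvgD; first exact: cvg_cst.
    apply/hcvgP => r r0; have r2 : 0 < r / 2 by rewrite divr_gt0.
    have /hcvgP/(_ _ r2)[n1 h1] := @hy x; have /hcvgP/(_ _ r2)[n2 h2] := @hy (y x).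
    exists (maxn n1 n2) => n; rewrite geq_max => /andP[n1n n2n].
    rewrite (le_lt_trans (hnorm_trans (sqrt_iter n (y x)) _ _))// [ltRHS]splitr.
    have [bn _ _] := adj n.
    by rewrite -(bopB bn) ltrD ?h2// (le_lt_trans (le1 _ _))// h1.
  have h2 : (fun n => 2%:R *: sqrt_iter n.+1 x) @ \oo --> 2%:R *: y x.
    by apply: cvgZr; have := @hy x; rewrite -cvg_shiftS.
  suff hE : (fun n => 2%:R *: sqrt_iter n.+1 x) =
      (fun n => t x + sqrt_iter n (sqrt_iter n x)).
    by rewrite hE in h2; exact: cvg_unique h2 h1.
  apply/funext => n; rewrite sqrt_iterS scalerA.
  have -> : (2%:R : R[i]) = (2%:R : R)%:C by rewrite rmorph_nat.
  by rewrite -rmorphM/= mulfV ?scale1r.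
have as_ : adjoint_pair (idfun - y) (idfun - y).
  split; [by apply: bopBf => //; exact: bop_id|by apply: bopBf => //; exact: bop_id|].
  by move=> u v; rewrite !fctE /= linearBl linearBr/= ay.
exists (idfun - y); split=> //.
  split; [by have [] := as_|] => x.
  rewrite !fctE /= linearBl/= dotxx.
  have cr : '[y x, x] \is Num.real by rewrite CrealE -dotC ay.
  rewrite -(RRe_real cr) -rmorphB ler0c subr_ge0.
  have := cauchy_schwarz (y x) x; rewrite -(RRe_real cr) {1}/cnorm.
  rewrite normc_def /= expr0n addr0 sqrtr_sqr => h.
  rewrite (le_trans (ler_norm _))// (le_trans h)// expr2.
  by rewrite ler_wpM2r ?hnorm_ge0.
move=> x; rewrite !fctE /= (bopB by_) opprB -addrA; congr (x + _).
have -> : y (y x) = y x + y x - t x by rewrite -mulr2n -scaler_nat yy addrC addKr.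
by rewrite addrAC addrK addKr.
Qed.

End SquareRoot.

(** The positive square root [s] of [x^* x] satisfies [|s u| = |x u|] for all [u],
    so each of [s] and [x] factors through the other; [x] is first scaled to a
    contraction, for which [1 - x^* x] is one as well. *)
Lemma polar_decomposition (e : nat -> H) (x : H -> H) :
  orthonormal_basis e -> bounded_ops H x ->
  exists s v w, [/\ positive_op dot s, bounded_ops H v, bounded_ops H w,
    s = v \o x & x = w \o s].
Proof.
move=> he bx; have [M M0 hM] := bopP bx.
pose z : H -> H := (M^-1)%:C *: x.
have bz : bounded_ops H z by exact: bopZf.
have z1 u : hnorm (z u) <= hnorm u.
  rewrite hnormZ cnormR ?invr_ge0 ?(ltW M0)// mulrC ler_pdivrMr// mulrC.
  exact: hM.
have [_ bz' zz'] := adjointP he bz; set z' := adjoint dot z in bz' zz'.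
have az : adjoint_pair z z' by [].
have azz : adjoint_pair (z' \o z) (z' \o z).
  by apply: adjoint_pair_comp => //; exact: adjoint_pair_sym.
pose t : H -> H := idfun - (z' \o z).
have tE u : t u = u - z' (z u) by [].
have at_ : adjoint_pair t t.
  have [b1 _ d1] := azz.
  split; [by apply: bopBf => //; exact: bop_id|by apply: bopBf => //; exact: bop_id|].
  by move=> u v; rewrite !tE linearBl linearBr/=; congr (_ - _); exact: d1.
have [_ z'1] := adjoint_contractive az (conj bz z1).
have t1 u : hnorm (t u) <= hnorm u.
  rewrite -(@ler_pXn2r _ 2) ?nnegrE ?hnorm_ge0// -lecR -!dotxx.
  have [_ _ z'z] := adjoint_pair_sym az.
  rewrite tE linearBl/= !linearBr/= z'z -[ '[u, z' _] ]zz' !dotxx -!rmorphB/= lecR.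
  have := z'1 (z u); rewrite -(@ler_pXn2r _ 2) ?nnegrE ?hnorm_ge0// => h1.
  by have := sqr_ge0 (hnorm (z u)); lra.
have [s0 [[bs _ ss] ps s2]] := sqrt_exists at_ t1.
have s0z u : hnorm (s0 u) = hnorm (z u).
  apply/eqP; rewrite -(@eqrXn2 _ 2) ?hnorm_ge0//; apply/eqP/complexI.
  rewrite -!dotxx -ss s2 tE opprB addrC subrK.
  by have [_ _ ->] := adjoint_pair_sym az.
have [v bv hv] := isometric_factor he bs bz s0z.
have [w bw hw] := isometric_factor he bz bs (fun u => esym (s0z u)).
exists s0, ((M^-1)%:C *: v), (M%:C *: w).
split=> //; [exact: bopZf|exact: bopZf|..].
  by rewrite hv; apply/funext => u; rewrite /= /z scalrfctE (bopZ bv).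
have zE u : x u = M%:C *: z u.
  by rewrite /z scalrfctE scalerA -rmorphM/= mulfV ?gt_eqF// scale1r.
by apply/funext => u; rewrite zE hw.
Qed.

(** * Finite-rank operators *)

Lemma finite_rank_comp_left a x : bounded_ops H a -> finite_rank_ops H x ->
  finite_rank_ops H (a \o x).
Proof.
move=> ba [bx [n [f fx]]]; split; first exact: bop_comp.
exists n, (fun i => a (f i)) => _ [u _ <-] /=.
have [c _ cE] := fx (x u) (imageT x u).
by exists c => //; rewrite -cE (bop_sum ba); apply: eq_bigr => i _; rewrite (bopZ ba).
Qed.

Lemma finite_rank_comp_right x b : finite_rank_ops H x -> bounded_ops H b ->
  finite_rank_ops H (x \o b).
Proof.
move=> [bx [n [f fx]]] bb; split; first exact: bop_comp.
by exists n, f => _ [u _ <-] /=; apply: fx; exists (b u).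
Qed.

Lemma finite_rank_add x y : finite_rank_ops H x -> finite_rank_ops H y ->
  finite_rank_ops H (x + y).
Proof.
move=> [bx [n [f fx]]] [by_ [m [g gy]]]; split; first exact: bopDf.
exists (n + m)%N, (fun i : 'I_(n + m) => match fintype.split i with inl j => f j | inr k => g k end).
move=> _ [u _ <-]; have [c _ cE] := fx _ (imageT x u).
have [d _ dE] := gy _ (imageT y u).
exists (fun i : 'I_(n + m) => match fintype.split i with inl j => c j | inr k => d k end) => //.
rewrite big_split_ord/= fctE -cE -dE; congr (_ + _); apply: eq_bigr => i _.
  by rewrite (unsplitK (inl i)).
by rewrite (unsplitK (inr i)).
Qed.

Lemma finite_rank_scale (c : R[i]) x : finite_rank_ops H x -> finite_rank_ops H (c *: x).
Proof.
move=> fx; rewrite (_ : c *: x = (c *: idfun) \o x)//.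
by apply: finite_rank_comp_left => //; apply: bopZf; exact: bop_id.
Qed.

Lemma finite_rank_rank_one f g : finite_rank_ops H (rank_one f g).
Proof.
split; first exact: bop_rank_one.
by exists 1%N, (fun=> f) => _ [u _ <-]; exists (fun=> '[u, g]); rewrite ?big_ord1.
Qed.

Lemma finite_rank0 : finite_rank_ops H 0.
Proof.
split; first exact: bop0f.
by exists 0%N, (fun=> 0) => _ [u _ <-]; exists (fun=> 0); rewrite ?big_ord0.
Qed.

(** * Unitary operators *)

Lemma unitary_intro u w : adjoint_pair u w -> u \o w = idfun -> w \o u = idfun ->
  unitary_ops dot u.
Proof. by move=> uw h1 h2; have [bu _ _] := uw; split; rewrite ?(adjoint_pairE uw). Qed.

Lemma unitary_id : unitary_ops dot idfun.
Proof. exact: (unitary_intro adjoint_pair_id). Qed.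

(** The condition says that [1 - c |z|^2], the eigenvalue at [z], has modulus 1. *)
Lemma unitary_rank_one_perturbation (c : R[i]) z :
  c + Num.conj c = c * Num.conj c * '[z, z] ->
  unitary_ops dot (idfun - c *: rank_one z z).
Proof.
move=> hc; have inv a b : a + b = a * b * '[z, z] ->
    (idfun - a *: rank_one z z) \o (idfun - b *: rank_one z z) = idfun.
  move=> hab; apply/funext => x /=; rewrite !fctE /= !rank_oneE.
  rewrite linearBl/= !scalerA dotZl.
  rewrite -addrA -opprD -scalerDl (_ : b * _ + _ = 0) ?scale0r ?subr0//.
  have -> : b * '[x, z] + a * ('[x, z] - b * '[x, z] * '[z, z]) =
    (a + b - a * b * '[z, z]) * '[x, z] by ring.
  by rewrite hab subrr mul0r.
apply: (@unitary_intro _ (idfun - Num.conj c *: rank_one z z)).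
- split; [by apply: bopBf; [exact: bop_id|apply: bopZf; exact: bop_rank_one]|
    by apply: bopBf; [exact: bop_id|apply: bopZf; exact: bop_rank_one]|].
  move=> x y; rewrite !fctE /= !rank_oneE linearBl linearBr/= !dotZl !dotZr.
  by rewrite conjCK -dotC; congr (_ - c * _); exact: mulrC.
- exact: inv.
- by apply: inv; rewrite addrC hc [c * _]mulrC.
Qed.

(** The complex form of a Householder reflection. With [z = g - h] and
    [k = 1 - <g, h> = <g, z>], the operator [1 - k^-1 z z^*] sends [g] to [g - z],
    and it is unitary because [|z|^2 = k + k^*]. *)
Lemma householder g h : hnorm g = 1 -> hnorm h = 1 -> exists w,
  [/\ unitary_ops dot w, finite_rank_ops H (w - idfun), w g = h &
      forall x, '[x, g] = 0 -> '[x, h] = 0 -> w x = x].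
Proof.
move=> g1 h1; have [->|gh] := eqVneq g h.
  exists idfun; split=> //; first exact: unitary_id.
  by rewrite subrr; exact: finite_rank0.
pose z := g - h; pose k := 1 - '[g, h].
have zz : '[z, z] = k + Num.conj k.
  rewrite linearBl/= !linearBr/= !unit_dot// [ '[h, g] ]dotC /k rmorphB rmorph1.
  ring.
have k0 : k != 0.
  apply: contra_neq gh => k0; apply/eqP; rewrite -subr_eq0; apply/eqP/hnorm_eq0.
  have := dotxx z; rewrite zz k0 rmorph0 addr0 => /complexI/esym/eqP.
  by rewrite sqrf_eq0 => /eqP.
have kJ0 : Num.conj k != 0 by rewrite conjC_eq0.
exists (idfun - k^-1 *: rank_one z z); split.
- apply: unitary_rank_one_perturbation; rewrite zz rmorphV ?unitfE//=.
  by field; rewrite k0 kJ0.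
- rewrite addrAC subrr sub0r -scaleN1r scalerA; apply: finite_rank_scale.
  exact: finite_rank_rank_one.
- rewrite !fctE /= rank_oneE {1}/z linearBr/= unit_dot// -/k scalerA mulVf//.
  by rewrite scale1r /z opprB addrC subrK.
- move=> x xg xh; rewrite !fctE /= rank_oneE {1}/z linearBr/= xg xh.
  by rewrite subrr scale0r scaler0 subr0.
Qed.

Section Unitary.
Variable e : nat -> H.
Hypothesis he : orthonormal_basis e.

Lemma unitaryP u : unitary_ops dot u ->
  [/\ adjoint_pair u (adjoint dot u), cancel (adjoint dot u) u,
      cancel u (adjoint dot u), contractive u & contractive (adjoint dot u)].
Proof.
move=> [bu h1 h2]; have au := adjointP he bu; have [_ _ uu] := au.
have K1 : cancel (adjoint dot u) u by move=> x; exact: (congr1 (fun f => f x) h1).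
have K2 : cancel u (adjoint dot u) by move=> x; exact: (congr1 (fun f => f x) h2).
have cu : contractive u.
  split=> // x; rewrite -(@ler_pXn2r _ 2) ?nnegrE ?hnorm_ge0// -lecR -!dotxx.
  by rewrite uu K2.
by split=> //; exact: adjoint_contractive au cu.
Qed.

Lemma unitary_comp u v : unitary_ops dot u -> unitary_ops dot v ->
  unitary_ops dot (u \o v).
Proof.
move=> /unitaryP[au u1 u2 _ _] /unitaryP[av v1 v2 _ _].
apply: (unitary_intro (adjoint_pair_comp au av)); apply/funext => x /=.
  by rewrite v1 u1.
by rewrite u2 v2.
Qed.

(** By induction on the rank: if [v] agrees with [u] on the range of [p], and [f] is
    a unit vector orthogonal to it, then [v f] and [u f] are both orthogonal to
    [u (range p)], so a Householder map that sends [v f] to [u f] corrects [v]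
    without disturbing the agreement. *)
Lemma unitary_finite_rank_extension n p u : finproj n p -> unitary_ops dot u ->
  exists v, unitary_group dot (finite_rank_ops H) v /\ forall x, v (p x) = u (p x).
Proof.
move=> fp uu; have [[bu _ ua] u1 u2 _ _] := unitaryP uu.
elim: fp => {n p} [|n p f fp [v [[uv fv] vp]] f1 pf].
  exists idfun; split; last by move=> x /=; rewrite (bop0 bu).
  by split; [exact: unitary_id|rewrite subrr; exact: finite_rank0].
have [[bv _ va] v1 v2 _ _] := unitaryP uv.
have iso w w' : (forall x y, '[w x, y] = '[x, w' y]) -> cancel w w' ->
    forall x y, '[w x, w y] = '[x, y] by move=> ww wK x y; rewrite ww wK.
have unit w w' : (forall x y, '[w x, y] = '[x, w' y]) -> cancel w w' -> hnorm (w f) = 1.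
  move=> ww wK; apply/eqP; rewrite -(@eqrXn2 _ 2) ?hnorm_ge0//; apply/eqP/complexI.
  by rewrite -!dotxx (iso _ _ ww wK) dotxx f1.
have [w [uw fw wv wx]] := householder (unit _ _ va v2) (unit _ _ ua u2).
have [_ _ ap] := finproj_adjoint fp.
exists (w \o v); split.
  split; first exact: unitary_comp.
  rewrite (_ : _ - _ = ((w - idfun) \o v) + (v - idfun)).
    by apply: finite_rank_add => //; exact: finite_rank_comp_right.
  by apply/funext => x; rewrite !fctE /= subrKA.
have [bw _ _] := uw.
move=> x /=; rewrite !fctE rank_oneE (bopD bv) (bopD bw) (bopD bu).
rewrite (bopZ bv) (bopZ bw) (bopZ bu) wv vp; congr (_ + _); apply: wx.
  by rewrite -vp (iso _ _ va v2) ap pf linear0r.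
by rewrite (iso _ _ ua u2) ap pf linear0r.
Qed.

End Unitary.

(** * Symmetrically normed ideals *)

Section Ideal.
Variable e : nat -> H.
Hypothesis he : orthonormal_basis e.
Variables (I : set (H -> H)) (N : (H -> H) -> R).
Hypothesis hI : symmetrically_normed_ideal dot I N.
Let hT := sni_ideal hI.
Let hN := sni_norm hI.

Lemma ideal_bop x : I x -> bounded_ops H x. Proof. exact: (tsi_bounded hT). Qed.

Lemma idealZ (c : R[i]) x : I x -> I (c *: x).
Proof.
move=> Ix; rewrite (_ : c *: x = (c *: idfun) \o x)//.
by apply: (tsiMl hT) => //; apply: bopZf; exact: bop_id.
Qed.

Lemma idealN x : I x -> I (- x).
Proof. by move=> /(idealZ (-1)); rewrite scaleN1r. Qed.

Lemma idealB x y : I x -> I y -> I (x - y).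
Proof. by move=> Ix /idealN; exact: (tsiD hT). Qed.

Lemma ideal_norm0 : N 0 = 0.
Proof.
have := norm_onZ hN 0 (tsi0 hT).
by rewrite scale0r /cnorm normr0 mul0r.
Qed.

Lemma ideal_normN x : I x -> N (- x) = N x.
Proof. by move=> Ix; rewrite -scaleN1r (norm_onZ hN)// /cnorm normrN1 mul1r. Qed.

Lemma ideal_distC x y : I x -> I y -> N (x - y) = N (y - x).
Proof. by move=> Ix Iy; rewrite -ideal_normN ?opprB//; exact: idealB. Qed.

Lemma ideal_norm_trans y x z : I x -> I y -> I z -> N (x - z) <= N (x - y) + N (y - z).
Proof.
move=> Ix Iy Iz; rewrite (le_trans _ (norm_onD hN _ _)) ?subrKA//; exact: idealB.
Qed.

Lemma ideal_norm_comp a x b : contractive a -> I x -> contractive b ->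
  N (a \o x \o b) <= N x.
Proof.
move=> ca Ix cb; rewrite (le_trans (sni_symmetric hI ca.1 Ix cb.1))//.
have a1 := contractive_opnorm ca; have b1 := contractive_opnorm cb.
have N0 := norm_on_ge0 hN Ix.
rewrite -[leRHS]mulr1 ler_pM// ?mulr_ge0 ?opnorm_ge0//; [exact: ca.1|exact: cb.1|].
by rewrite ler_piMl.
Qed.

Lemma ideal_norm_left a x : contractive a -> I x -> N (a \o x) <= N x.
Proof. by move=> ca Ix; exact: ideal_norm_comp ca Ix contractive_id. Qed.

Lemma ideal_norm_right x b : I x -> contractive b -> N (x \o b) <= N x.
Proof. by move=> Ix cb; exact: ideal_norm_comp contractive_id Ix cb. Qed.

Lemma rank_one_comp f g f' g' x : bounded_ops H x ->
  rank_one f g \o x \o rank_one f' g' = '[x f', g] *: rank_one f g'.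
Proof.
move=> bx; apply/funext => u; rewrite /= scalrfctE !rank_oneE (bopZ bx) dotZl.
by rewrite scalerA mulrC.
Qed.

(** If [x u] is not zero, [f (x u)^*] and [u g^*] squeeze [x] to a nonzero multiple
    of [f g^*]. *)
Lemma ideal_rank_one f g : I (rank_one f g).
Proof.
have [x Ix x0] := sni_nonzero hI; have bx := ideal_bop Ix.
have [u xu] : exists u, x u != 0.
  apply: contrapT => h; apply: x0; apply/funext => u; apply/eqP/negPn/negP => xu.
  by apply: h; exists u.
have nz : '[x u, x u] != 0.
  rewrite dotxx; apply: contra_neq xu => /complexI/eqP.
  by rewrite sqrf_eq0 => /eqP/hnorm_eq0.
have := idealZ '[x u, x u]^-1 (tsiMr hT (tsiMl hT (bop_rank_one f (x u)) Ix)
  (bop_rank_one u g)).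
by rewrite (rank_one_comp _ _ _ _ bx) scalerA mulVf// scale1r.
Qed.

Lemma opnorm_rank_one f g : opnorm (rank_one f g) <= hnorm f * hnorm g.
Proof.
apply: opnorm_le => [x|]; last by rewrite mulr_ge0 ?hnorm_ge0.
rewrite rank_oneE hnormZ -mulrA mulrC ler_wpM2l ?hnorm_ge0//.
by rewrite mulrC cauchy_schwarz.
Qed.

Lemma norm_unit_projection f : hnorm f = 1 -> N (rank_one f f) = 1.
Proof.
move=> f1; apply: (sni_normalized hI); split.
- exact: bop_rank_one.
- by apply/funext => x /=; rewrite !rank_oneE dotZl unit_dot// mulr1.
- exact: adjoint_pairE (adjoint_pair_rank_one f f).
- exists f; first by apply/eqP => f0; move: f1; rewrite f0 hnorm0 => /eqP; rewrite eq_sym oner_eq0.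
  apply/seteqP; split=> [_ [x _ <-]|_ [c _ <-]]; first by exists '[x, f].
  by exists (c *: f) => //; rewrite rank_oneE dotZl unit_dot// mulr1.
Qed.

Lemma ideal_norm_rank_one f g : N (rank_one f g) <= hnorm f * hnorm g.
Proof.
have e1 := basis_norm he 0.
have -> : rank_one f g = rank_one f (e 0) \o rank_one (e 0) (e 0) \o rank_one (e 0) g.
  by rewrite rank_one_comp ?rank_oneE ?unit_dot ?scale1r ?unit_dot ?scale1r//; exact: bop_rank_one.
rewrite (le_trans (sni_symmetric hI (bop_rank_one _ _) (ideal_rank_one _ _) (bop_rank_one _ _)))//.
rewrite norm_unit_projection// mulr1.
have := opnorm_rank_one f (e 0); have := opnorm_rank_one (e 0) g.
rewrite e1 mul1r mulr1 => h1 h2.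
by apply: ler_pM => //; apply: opnorm_ge0; exact: bop_rank_one.
Qed.

(** [(e (x u)^* ) x (u e^* )] is [|x u|^2] times a rank-one projection when [e] is a
    unit vector. *)
Lemma ideal_norm_ub x u : I x -> hnorm (x u) <= N x * hnorm u.
Proof.
move=> Ix; have e1 := basis_norm he 0; have N0 := norm_on_ge0 hN Ix.
have [->|xu] := eqVneq (hnorm (x u)) 0; first by rewrite mulr_ge0 ?hnorm_ge0.
have xu0 : 0 < hnorm (x u) by rewrite lt_neqAle eq_sym xu hnorm_ge0.
have := sni_symmetric hI (bop_rank_one (e 0) (x u)) Ix (bop_rank_one u (e 0)).
rewrite (rank_one_comp _ _ _ _ (ideal_bop Ix)) (norm_onZ hN); last exact: ideal_rank_one.
rewrite norm_unit_projection// mulr1 dotxx cnormR ?sqr_ge0// => h.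
have h1 := opnorm_rank_one (e 0) (x u); have h2 := opnorm_rank_one u (e 0).
rewrite e1 mul1r in h1; rewrite e1 mulr1 in h2.
rewrite -(ler_pM2l xu0) -expr2 (le_trans h)// mulrA.
apply: ler_pM => //; rewrite ?mulr_ge0 ?opnorm_ge0//; try exact: bop_rank_one.
by rewrite ler_wpM2r.
Qed.

Lemma opnorm_le_ideal_norm x : I x -> opnorm x <= N x.
Proof.
move=> Ix; apply: opnorm_le; last exact: norm_on_ge0 hN _ Ix.
by move=> u; exact: ideal_norm_ub.
Qed.

Lemma finproj_ideal n p : finproj n p -> I p.
Proof.
elim=> {n p} [|n p f _ Ip _ _]; first exact: tsi0 hT.
by apply: (tsiD hT) => //; exact: ideal_rank_one.
Qed.

Lemma finite_rank_ideal : finite_rank_ops H `<=` I.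
Proof.
move=> x [bx /finite_dim_finproj[n [p [fp px]]]].
rewrite (_ : x = p \o x); first by apply: (tsiMr hT) => //; exact: finproj_ideal fp.
by apply/funext => u /=; rewrite px//; exists u.
Qed.

(** [p] is a sum of [n] rank-one projections, each of ideal norm 1. *)
Lemma finproj_norm_left n p y (M : R) : finproj n p -> bounded_ops H y ->
  (forall x, hnorm (y x) <= M * hnorm x) -> 0 <= M -> N (p \o y) <= M *+ n.
Proof.
move=> fp by_ yM M0; elim: fp => {n p} [|n p f fp IH f1 pf].
  by rewrite (_ : 0 \o y = 0)// ideal_norm0.
have -> : (p + rank_one f f) \o y = (p \o y) + (rank_one f f \o y) by [].
have If := ideal_rank_one f f.
rewrite mulrSr (le_trans (norm_onD hN _ _))//.
- by apply: (tsiMr hT) => //; exact: finproj_ideal fp.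
- exact: (tsiMr hT).
rewrite lerD//.
have := sni_symmetric hI bop_id If by_; rewrite norm_unit_projection// mulr1.
move=> h; apply: (le_trans h); rewrite -[leRHS]mul1r ler_pM ?opnorm_ge0//; first exact: bop_id.
- exact: contractive_opnorm contractive_id.
- exact: opnorm_le.
Qed.

Lemma finproj_norm_right n p y (M : R) : finproj n p -> bounded_ops H y ->
  (forall x, hnorm (y x) <= M * hnorm x) -> 0 <= M -> N (y \o p) <= M *+ n.
Proof.
move=> fp by_ yM M0; elim: fp => {n p} [|n p f fp IH f1 pf].
  rewrite (_ : y \o 0 = 0) ?ideal_norm0//.
  by apply/funext => x /=; rewrite (bop0 by_).
have -> : y \o (p + rank_one f f) = (y \o p) + (y \o rank_one f f).
  by apply/funext => x; rewrite !fctE /= (bopD by_).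
have If := ideal_rank_one f f.
rewrite mulrSr (le_trans (norm_onD hN _ _))//.
- by apply: (tsiMl hT) => //; exact: finproj_ideal fp.
- exact: (tsiMl hT).
rewrite lerD//.
have := sni_symmetric hI by_ If bop_id; rewrite norm_unit_projection// mulr1.
move=> h; apply: (le_trans h); rewrite -[leRHS]mulr1 ler_pM ?opnorm_ge0//; first exact: bop_id.
- exact: opnorm_le.
- exact: contractive_opnorm contractive_id.
Qed.

End Ideal.

Definition conj_op (u a : H -> H) : H -> H := u \o a \o adjoint dot u.

Section MainIdeal.
Variable e : nat -> H.
Hypothesis he : orthonormal_basis e.
Variables (I : set (H -> H)) (N : (H -> H) -> R).
Hypothesis hI : symmetrically_normed_ideal dot I N.
Let hT := sni_ideal hI.
Let hN := sni_norm hI.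

(** * Separable ideals *)

(** The axioms on [r S] are common to [y |-> y p_S] and [y |-> p_S y], where [p_S]
    is the projection onto the coordinates in [S]. *)
Section Restriction.
Variable r : (nat -> bool) -> (H -> H) -> (H -> H).
Hypothesis rI : forall S y, I y -> I (r S y).
Hypothesis r_le : forall S y, I y -> N (r S y) <= N y.
Hypothesis rB : forall S y z, I y -> I z -> r S (y - z) = r S y - r S z.
Hypothesis rr : forall S T y, I y -> r S (r T y) = r (fun k => S k && T k) y.
Hypothesis rsplit : forall (S T : nat -> bool) y, I y -> (forall k, T k -> S k) ->
  r S y = r T y + r (fun k => S k && ~~ T k) y.

Lemma restriction_empty y : I y -> r (fun=> false) y = 0.
Proof.
move=> Iy; have := @rsplit (fun=> false) (fun=> false) y Iy (fun _ h => h).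
by move=> /= h; apply: (@addrI _ (r (fun=> false) y)); rewrite addr0; exact: (esym h).
Qed.

(** Cantor's diagonal argument: two different unions of blocks differ by at least
    [eps] on some block. Given a dense sequence [d], take the union [S] that omits
    block [j] exactly when [d j] is close to a union containing block [j]; no term
    of [d] is close to [S]. *)
Lemma separable_blocks (y : H -> H) (eps : R) (b c : nat -> nat) :
  separable_on I N -> I y -> 0 < eps ->
  (forall j, (b j <= c j)%N) -> (forall j, (c j <= b j.+1)%N) ->
  ~ forall j, eps <= N (r (fun k => (b j <= k < c j)%N) y).
Proof.
move=> [D [cD DI ID]] Iy eps0 bc cb big.
have [d hd] := countable_enum (0 : H -> H) cD.
have bb i j : (i < j)%N -> (c i <= b j)%N.
  elim: j => // j IH; rewrite ltnS leq_eqVlt => /predU1P[->//|/IH ij].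
  by rewrite (leq_trans ij)// (leq_trans (bc j)).
pose B (S : nat -> bool) k := `[< exists j, S j /\ (b j <= k < c j)%N >].
(* The blocks are disjoint, so block [j] meets a union in itself or not at all. *)
have BE (S : nat -> bool) j k : (b j <= k < c j)%N && B S k = (b j <= k < c j)%N && S j.
  have [/andP[bk kc]|//] := boolP (b j <= k < c j)%N; rewrite /=.
  apply/asboolP/idP => [[i [Si /andP[bik kci]]]|Sj]; last by exists j; rewrite bk.
  have [ij|ji|<-//] := ltngtP i j.
    by have := leq_trans kci (leq_trans (bb _ _ ij) bk); rewrite ltnn.
  by have := leq_trans kc (leq_trans (bb _ _ ji) bik); rewrite ltnn.
have sep (S T : nat -> bool) j : T j -> ~~ S j -> eps <= N (r (B T) y - r (B S) y).
  move=> Tj Sj; apply: (le_trans (big j)).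
  rewrite -[X in N X <= _]subr0 -(restriction_empty Iy).
  have -> : r (fun k => (b j <= k < c j)%N) y = r (fun k => (b j <= k < c j)%N) (r (B T) y).
    by rewrite rr//; congr (r _ y); apply/funext => k; rewrite BE Tj andbT.
  have -> : r (fun=> false) y = r (fun k => (b j <= k < c j)%N) (r (B S) y).
    by rewrite rr//; congr (r _ y); apply/funext => k; rewrite BE (negPf Sj) andbF.
  by rewrite -rB ?r_le//; try apply: (idealB hI); exact: rI.
pose near_T j (T : nat -> bool) := T j /\ N (r (B T) y - d j) < eps / 2.
pose S j := ~~ `[< exists T, near_T j T >].
have [s Ds sd] := (ID _ (rI (B S) Iy)).2 (eps / 2) (divr_gt0 eps0 (ltr0n _ 2)).
have [j dj] := hd _ Ds; have Is := DI _ Ds; rewrite -dj in sd Is.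
have [Sj|Sj] := boolP (S j).
  by move/negP: (Sj); apply; apply/asboolP; exists S.
have /negPn/asboolP[T [Tj Td]] := Sj.
have := sep S T j Tj Sj; apply/negP; rewrite -ltNge.
have IB S' : I (r (B S') y) by exact: rI.
rewrite (le_lt_trans (ideal_norm_trans hI (IB T) Is (IB S)))// [ltRHS]splitr.
by rewrite ltrD// (ideal_distC hI).
Qed.

Lemma restriction_cauchy (y : H -> H) (eps : R) :
  separable_on I N -> I y -> 0 < eps ->
  exists n0, forall m n, (n0 <= m)%N -> (m <= n)%N ->
    N (r (fun k => (m <= k < n)%N) y) < eps.
Proof.
move=> sep Iy eps0; apply: contrapT => h.
have /(_ _)/cid-/all_sig[f hf] : forall n0, exists mn : nat * nat,
    [/\ (n0 <= mn.1)%N, (mn.1 <= mn.2)%N &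
      eps <= N (r (fun k => (mn.1 <= k < mn.2)%N) y)].
  move=> n0; apply: contrapT => h'; apply: h; exists n0 => m n n0m mn.
  by rewrite ltNge; apply/negP => le; apply: h'; exists (m, n).
(* Each block starts beyond the end of the previous one. *)
pose g := fix g j := if j is i.+1 then f (g i).2 else f 0%N.
apply: (@separable_blocks y eps (fun j => (g j).1) (fun j => (g j).2)) => //.
- by case=> [|j] /=; [have [] := hf 0%N|have [] := hf (g j).2].
- by move=> j /=; have [] := hf (g j).2.
- by case=> [|j] /=; [have [] := hf 0%N|have [] := hf (g j).2].
Qed.

Lemma restriction_limit (y : H -> H) : separable_on I N -> I y ->
  (forall l, I l -> (forall eps : R, 0 < eps -> exists n0, forall n, (n0 <= n)%N ->
     N (r (fun k => (k < n)%N) y - l) < eps) -> l = y) ->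
  forall eps : R, 0 < eps -> exists n0, forall n, (n0 <= n)%N ->
     N (y - r (fun k => (k < n)%N) y) < eps.
Proof.
move=> sep Iy lim_ eps eps0; pose u n := r (fun k => (k < n)%N) y.
have Iu n : I (u n) by exact: rI.
have uB m n : (m <= n)%N -> u n - u m = r (fun k => (m <= k < n)%N) y.
  move=> mn; rewrite /u (@rsplit (fun k => (k < n)%N) (fun k => (k < m)%N))//; last first.
    by move=> k km; exact: (leq_trans km mn).
  rewrite addrAC subrr add0r; congr (r _ y); apply/funext => k.
  by rewrite -leqNgt andbC.
have cau (e0 : R) : 0 < e0 -> exists n0, forall m n, (n0 <= m)%N -> (n0 <= n)%N ->
    N (u m - u n) < e0.
  move=> e00; have [n0 hn0] := restriction_cauchy sep Iy e00; exists n0 => m n n0m n0n.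
  have [mn|/ltnW nm] := leqP m n; first by rewrite (ideal_distC hI)// uB// hn0.
  by rewrite uB// hn0.
have [l Il ul] := sni_complete hI Iu cau.
have ul' (e0 : R) : 0 < e0 -> exists n0, forall n, (n0 <= n)%N -> N (u n - l) < e0.
  move=> e00; move/cvgrPdist_lt : ul => /(_ _ e00)[n0 _ hn0]; exists n0 => n n0n.
  have := hn0 n n0n; rewrite /= sub0r normrN ger0_norm//.
  by apply: (norm_on_ge0 hN); exact: (idealB hI).
have ly := lim_ l Il ul'; rewrite ly in ul'.
have [n0 hn0] := ul' _ eps0; exists n0 => n n0n.
by rewrite (ideal_distC hI Iy (Iu n)); exact: hn0.
Qed.

End Restriction.

(** Convergence in the ideal implies pointwise convergence, since the ideal norm
    dominates the operator norm. *)
Lemma ideal_limit_eq (u : nat -> H -> H) (x l : H -> H) :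
  (forall n, I (u n)) -> I l ->
  (forall eps : R, 0 < eps -> exists n0, forall n, (n0 <= n)%N -> N (u n - l) < eps) ->
  (forall v, u n v @[n --> \oo] --> x v) -> l = x.
Proof.
move=> Iu Il ul ux; apply/funext => v.
suff lv : u n v @[n --> \oo] --> l v by exact: (cvg_unique _ lv (ux v)).
apply/hcvgP => eps eps0.
have v1 : 0 < hnorm v + 1 by rewrite ltr_wpDl ?hnorm_ge0.
have [n0 hn0] := ul _ (divr_gt0 eps0 v1); exists n0 => n /hn0.
have Id : I (u n - l) by exact: (idealB hI).
rewrite ltr_pdivlMr// => /(le_lt_trans _); apply.
rewrite (le_trans (ideal_norm_ub he hI v Id))// ler_wpM2l ?lerDl//.
exact: (norm_on_ge0 hN).
Qed.

Lemma separable_approx a (eps : R) : separable_on I N -> I a -> 0 < eps ->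
  exists n p, [/\ finproj n p, N (a - (a \o p)) < eps & N (a - (p \o a)) < eps].
Proof.
move=> sep Ia eps0; have ba := ideal_bop hI Ia.
have cS S := coord_proj_contractive he S.
have bS S := coord_proj_bop he S.
have Ir S y : I y -> I (y \o coord_proj e S) by move=> Iy; exact: (tsiMr hT).
have Il S y : I y -> I (coord_proj e S \o y) by move=> Iy; exact: (tsiMl hT).
have lin y : I y -> forall u v, y (u + v) = y u + y v.
  by move=> Iy; exact: (bopD (ideal_bop hI Iy)).
have pcvg v : coord_proj e (fun k => (k < n)%N) v @[n --> \oo] --> v.
  rewrite (_ : (fun n => _) = (fun n => partial_op e e n v)); first exact: he.2.
  by apply/funext => n; rewrite (coord_proj_ltn he).
have [||||||n1 h1] := @restriction_limit (fun S y => y \o coord_proj e S) _ _ _ _ _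
    a sep Ia _ eps eps0.
- exact: Ir.
- by move=> S y Iy; exact: (ideal_norm_right hI).
- by [].
- move=> S T y Iy; rewrite -compA (coord_projI he); congr (y \o coord_proj e _).
  by apply/funext => k; rewrite andbC.
- move=> S T y Iy TS; rewrite (coord_proj_split he TS).
  by apply/funext => v; rewrite !fctE /= lin.
- move=> l Il_ hl; apply: (ideal_limit_eq _ Il_ hl) => [n|v]; first exact: Ir.
  exact: (bop_cvg ba (@pcvg v)).
have [||||||n2 h2] := @restriction_limit (fun S y => coord_proj e S \o y) _ _ _ _ _
    a sep Ia _ eps eps0.
- exact: Il.
- by move=> S y Iy; exact: (ideal_norm_left hI).
- by move=> S y z _ _; apply/funext => v; rewrite /= !fctE /= (bopB (bS S)).
- by move=> S T y Iy; rewrite compA (coord_projI he).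
- move=> S T y Iy TS; rewrite {1}(coord_proj_split he TS)//.
- move=> l Il_ hl; apply: (ideal_limit_eq _ Il_ hl) => [n|v]; first exact: Il.
  exact: pcvg.
pose n := maxn n1 n2; exists n, (partial_op e e n); rewrite -(coord_proj_ltn he).
split.
- by rewrite (coord_proj_ltn he); exact: finproj_partial_op.
- exact: (h1 n (leq_maxl _ _)).
- exact: (h2 n (leq_maxr _ _)).
Qed.

(** * Unitary orbits *)

Lemma conj_op_ideal u a : unitary_ops dot u -> I a -> I (conj_op u a).
Proof.
move=> /(unitaryP he)[_ _ _ cu cu'] Ia.
exact: (tsiMr hT (tsiMl hT cu.1 Ia) cu'.1).
Qed.

(** On the unitary orbit of an approximable operator the two norms are uniformly
    equivalent up to [eps]: with [q = u p u^*] and [q' = v p v^*], the difference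
    [d] is [q d + (1 - q) d q' + (1 - q) d (1 - q')], where the first two terms
    factor through [p] and the last one is small. *)
Lemma orbit_norm_le n p a u v (eps M : R) : finproj n p -> I a ->
  N (a - (a \o p)) <= eps -> N (a - (p \o a)) <= eps ->
  unitary_ops dot u -> unitary_ops dot v ->
  0 <= M -> (forall x, hnorm ((conj_op u a - conj_op v a) x) <= M * hnorm x) ->
  N (conj_op u a - conj_op v a) <= M *+ n + M *+ n + (eps + eps).
Proof.
move=> fp Ia ap pa uu uv M0 hM; have ba := ideal_bop hI Ia.
have [au u1 u2 cu cu'] := unitaryP he uu; have [av v1 v2 cv cv'] := unitaryP he uv.
have Id : I (conj_op u a - conj_op v a).
  by apply: (idealB hI); exact: conj_op_ideal.
set d := conj_op u a - conj_op v a in Id hM *; have bd := ideal_bop hI Id.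
set u' := adjoint dot u in au u1 u2 cu'; set v' := adjoint dot v in av v1 v2 cv'.
have cp := finproj_contractive fp; have cq := contractiveC fp.
have [bp bq] := (cp.1, cq.1).
have cqu : contractive (u \o (idfun - p) \o u') by do 2!apply: contractive_comp => //.
have cqv : contractive (v \o (idfun - p) \o v') by do 2!apply: contractive_comp => //.
have dE : d = (u \o (p \o (u' \o d)))
   + ((((u \o (idfun - p) \o u') \o d \o v) \o p) \o v')
   + ((u \o (a - (p \o a)) \o (u' \o (v \o (idfun - p) \o v')))
   - (((u \o (idfun - p) \o u') \o v) \o (a - (a \o p)) \o v')).
  apply/funext => x; rewrite !fctE /=.
  pose Q z := u (u' z - p (u' z)); have bQ : bounded_ops H Q := cqu.1.
  pose y2 := v (v' x - p (v' x)).
  have QE z : Q z = z - u (p (u' z)) by rewrite /Q (bopB cu.1) u1.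
  have -> : u (a (u' y2) - p (a (u' y2))) = Q (u (a (u' y2))) by rewrite /Q u2.
  have -> : v (a (v' x) - a (p (v' x))) = v (a (v' y2)) by rewrite /y2 v2 (bopB ba).
  rewrite -!/(Q _) -(bopB bQ) -addrA -(bopD bQ).
  rewrite -[u (a _) - _]/(d y2) -(bopD bd) /y2 -(bopD cv.1) [p _ + _]addrC subrK v1.
  by rewrite QE addrC subrK.
have n1 : N (u \o (p \o (u' \o d))) <= M *+ n.
  have bud := bop_comp cu'.1 bd.
  rewrite (le_trans (ideal_norm_left hI cu _))//.
    by apply: (tsiMr hT) => //; exact: (finproj_ideal hI fp).
  apply: (finproj_norm_left hI fp bud) => // x.
  by rewrite (le_trans (cu'.2 _)).
have n2 : N ((((u \o (idfun - p) \o u') \o d \o v) \o p) \o v') <= M *+ n.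
  have bqd : bounded_ops H ((u \o (idfun - p) \o u') \o d \o v).
    by apply: (bop_comp _ cv.1); exact: (bop_comp cqu.1 bd).
  rewrite (le_trans (ideal_norm_right hI _ cv'))//.
    by apply: (tsiMl hT) => //; exact: (finproj_ideal hI fp).
  apply: (finproj_norm_right hI fp bqd) => // x.
  by rewrite (le_trans (cqu.2 _))// (le_trans (hM _))// ler_wpM2l// cv.2.
have Iap : I (a - (a \o p)) by apply: (idealB hI) => //; exact: (tsiMr hT).
have Ipa : I (a - (p \o a)) by apply: (idealB hI) => //; exact: (tsiMl hT).
have c3 := contractive_comp cu' cqv; have c4 := contractive_comp cqu cv.
have n3 : N (u \o (a - (p \o a)) \o (u' \o (v \o (idfun - p) \o v'))) <= eps.
  exact: (le_trans (ideal_norm_comp hI cu Ipa c3)).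
have n4 : N (((u \o (idfun - p) \o u') \o v) \o (a - (a \o p)) \o v') <= eps.
  exact: (le_trans (ideal_norm_comp hI c4 Iap cv')).
have Ip := finproj_ideal hI fp.
have I1 : I (u \o (p \o (u' \o d))).
  exact: (tsiMl hT cu.1 (tsiMr hT Ip (bop_comp cu'.1 bd))).
have I2 : I ((((u \o (idfun - p) \o u') \o d \o v) \o p) \o v').
  exact: (tsiMr hT (tsiMl hT (bop_comp (bop_comp cqu.1 bd) cv.1) Ip) cv'.1).
have I3 : I (u \o (a - (p \o a)) \o (u' \o (v \o (idfun - p) \o v'))).
  exact: (tsiMr hT (tsiMl hT cu.1 Ipa) c3.1).
have I4 : I (((u \o (idfun - p) \o u') \o v) \o (a - (a \o p)) \o v').
  exact: (tsiMr hT (tsiMl hT c4.1 Iap) cv'.1).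
rewrite dE (le_trans (norm_onD hN _ _))//; [exact: (tsiD hT)|exact: (idealB hI)|].
apply: lerD; first by rewrite (le_trans (norm_onD hN _ _))// lerD.
by rewrite (le_trans (norm_onD hN _ _))// ?(ideal_normN hI)// ?lerD//; exact: (idealN hI).
Qed.

(** Both conjugates of [p a p] agree, and [a] differs from [p a p] by
    [(a - p a) + p (a - a p)]. *)
Lemma conj_op_finite_rank n p a u (eps : R) : finproj n p -> I a ->
  N (a - (a \o p)) <= eps -> N (a - (p \o a)) <= eps -> unitary_ops dot u ->
  exists v, unitary_group dot (finite_rank_ops H) v /\
    N (conj_op u a - conj_op v a) <= (eps + eps) + (eps + eps).
Proof.
move=> fp Ia ap pa uu; have [v [[uv fv] vp]] := unitary_finite_rank_extension he fp uu.
exists v; split=> //; have ba := ideal_bop hI Ia.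
have [au u1 u2 cu cu'] := unitaryP he uu; have [av v1 v2 cv cv'] := unitaryP he uv.
have Iap : I (a - (a \o p)) by apply: (idealB hI) => //; exact: (tsiMr hT _ (finproj_bop fp)).
have Ipa : I (a - (p \o a)) by apply: (idealB hI) => //; exact: (tsiMl hT (finproj_bop fp)).
have cp := finproj_contractive fp.
have pv x : p (adjoint dot v x) = p (adjoint dot u x).
  have [_ _ pp] := finproj_adjoint fp; have [_ _ uu'] := au; have [_ _ vv'] := av.
  by apply: dot_eqP => z; rewrite !pp dotC -vv' vp uu' -dotC.
have split w : unitary_ops dot w -> exists r, [/\ I r, N r <= eps + eps &
    conj_op w a = r + (w \o (p \o (a \o (p \o adjoint dot w))))].
  move=> uw; have [_ w1 w2 cw cw'] := unitaryP he uw.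
  have I1 : I (w \o (a - (p \o a)) \o adjoint dot w).
    exact: (tsiMr hT (tsiMl hT cw.1 Ipa) cw'.1).
  have cwp := contractive_comp cw cp.
  have I2 : I ((w \o p) \o (a - (a \o p)) \o adjoint dot w).
    exact: (tsiMr hT (tsiMl hT cwp.1 Iap) cw'.1).
  exists ((w \o (a - (p \o a)) \o adjoint dot w) +
          ((w \o p) \o (a - (a \o p)) \o adjoint dot w)); split.
  - exact: (tsiD hT).
  - rewrite (le_trans (norm_onD hN _ _))// lerD//.
      exact: (le_trans (ideal_norm_comp hI cw Ipa cw')).
    exact: (le_trans (ideal_norm_comp hI cwp Iap cw')).
  - apply/funext => x; rewrite !fctE /= -addrA -(bopD cw.1) -(bopD cp.1) subrK.
    by rewrite -(bopD cw.1) subrK.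
have [r [Ir Nr ->]] := split u uu; have [s [Is Ns ->]] := split v uv.
have -> : v \o (p \o (a \o (p \o adjoint dot v))) = u \o (p \o (a \o (p \o adjoint dot u))).
  by apply/funext => x /=; rewrite vp pv.
rewrite opprD addrACA subrr addr0; apply: (le_trans (norm_onD hN Ir (idealN hI Is))).
by rewrite lerD// (ideal_normN hI).
Qed.

Lemma norm_closure_subset S T : (forall t, T t -> I t) ->
  S `<=` I -> T `<=` norm_closure I N S -> norm_closure I N T `<=` norm_closure I N S.
Proof.
move=> TI SI TS b [Ib hb]; split=> // eps eps0; have eps2 : 0 < eps / 2 by rewrite divr_gt0.
have [t Tt bt] := hb _ eps2; have [It ht] := TS t Tt; have [s Ss ts] := ht _ eps2.
exists s => //; rewrite (le_lt_trans (ideal_norm_trans hI Ib It (SI _ Ss)))//.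
by rewrite [ltRHS]splitr ltrD.
Qed.

Lemma unitary_orbit_ideal J a : I a -> unitary_orbit dot J a `<=` I.
Proof. by move=> Ia _ [u [uu _] <-]; exact: conj_op_ideal. Qed.

Lemma unitary_orbit_mono J K a : J `<=` K ->
  unitary_orbit dot J a `<=` unitary_orbit dot K a.
Proof. by move=> JK _ [u [uu Ju] <-]; exists u => //; split=> //; exact: JK. Qed.

Lemma orbit_in_finite_rank_closure a : separable_on I N -> I a ->
  unitary_orbit dot (bounded_ops H) a
    `<=` norm_closure I N (unitary_orbit dot (finite_rank_ops H) a).
Proof.
move=> sep Ia _ [u [uu _] <-]; split=> [|eps eps0]; first exact: conj_op_ideal.
have eps8 : 0 < eps / 8%:R by rewrite divr_gt0.
have [n [p [fp /ltW ap /ltW pa]]] := separable_approx sep Ia eps8.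
have [v [vF vN]] := conj_op_finite_rank fp Ia ap pa uu.
exists (conj_op v a); first by exists v.
by apply: (le_lt_trans vN); lra.
Qed.

(** By [orbit_norm_le], conjugates of [a] that converge in operator norm form a
    Cauchy sequence in the ideal; its limit there is the same operator. *)
Lemma orbit_opnorm_closure a : separable_on I N -> I a ->
  norm_closure (bounded_ops H) (@opnorm R H) (unitary_orbit dot (bounded_ops H) a)
    `<=` norm_closure I N (unitary_orbit dot (bounded_ops H) a).
Proof.
move=> sep Ia b [bb hb].
have /(_ _)/cid-/all_sig[u hu] : forall k : nat, exists u, unitary_ops dot u /\
    opnorm (b - conj_op u a) < k.+1%:R^-1.
  move=> k; have k0 : 0 < k.+1%:R^-1 :> R by rewrite invr_gt0.
  by have [_ [u [uu _] <-] bu] := hb _ k0; exists u.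
pose c k := conj_op (u k) a; pose delta k : R := k.+1%:R^-1.
have Ic k : I (c k) by apply: conj_op_ideal => //; exact: (hu k).1.
have bc k : bounded_ops H (c k) by exact: (ideal_bop hI (Ic k)).
have d0 k : 0 <= delta k by rewrite invr_ge0.
have dlim (eps : R) : 0 < eps -> exists n0, forall k, (n0 <= k)%N -> delta k < eps.
  move=> eps0; have /cvgrPdist_lt/(_ _ eps0)[n0 _ hn0] := @cvg_harmonic R.
  exists n0 => k /hn0; rewrite /= sub0r normrN ger0_norm//; exact: d0.
have bcx k x : hnorm (b x - c k x) <= delta k * hnorm x.
  have bbc := bopBf bb (bc k).
  rewrite (le_trans (opnorm_ub x bbc))// ler_wpM2r ?hnorm_ge0// ltW//.
  exact: (hu k).2.
have cc m n x : hnorm ((c m - c n) x) <= (delta m + delta n) * hnorm x.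
  rewrite (_ : (c m - c n) x = c m x - c n x)//.
  rewrite (le_trans (hnorm_trans (b x) _ _))// mulrDl lerD//.
  by rewrite hdistC.
have cau (eps : R) : 0 < eps -> exists n0, forall m n, (n0 <= m)%N -> (n0 <= n)%N ->
    N (c m - c n) < eps.
  move=> eps0; have eps8 : 0 < eps / 8%:R by rewrite divr_gt0.
  have [d [p [fp /ltW ap /ltW pa]]] := separable_approx sep Ia eps8.
  have d1 : 0 < d.+1%:R :> R by [].
  have [n0 hn0] := dlim _ (divr_gt0 eps8 d1); exists n0 => m n /hn0 hm /hn0 hn.
  have M0 : 0 <= delta m + delta n by rewrite addr_ge0.
  have := orbit_norm_le fp Ia ap pa (hu m).1 (hu n).1 M0 (cc m n).
  move/le_lt_trans; apply.
  have h : (delta m + delta n) *+ d <= eps / 8%:R + eps / 8%:R.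
    rewrite -[_ *+ d]mulr_natr; apply: (@le_trans _ _ ((delta m + delta n) * d.+1%:R)).
      by rewrite ler_wpM2l// ler_nat.
    by rewrite mulrDl lerD// -ler_pdivlMr// ltW.
  by lra.
have [l Il cl] := sni_complete hI Ic cau.
have cl' (eps : R) : 0 < eps -> exists n0, forall n, (n0 <= n)%N -> N (c n - l) < eps.
  move=> e00; move/cvgrPdist_lt : cl => /(_ _ e00)[n0 _ hn0]; exists n0 => n n0n.
  have := hn0 n n0n; rewrite /= sub0r normrN ger0_norm//.
  by apply: (norm_on_ge0 hN); exact: (idealB hI).
have lb : l = b.
  apply: (ideal_limit_eq Ic Il cl') => v; apply/hcvgP => eps eps0.
  have v1 : 0 < hnorm v + 1 by rewrite ltr_wpDl ?hnorm_ge0.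
  have [n0 hn0] := dlim _ (divr_gt0 eps0 v1); exists n0 => n /hn0.
  rewrite ltr_pdivlMr// hdistC => /(le_lt_trans _); apply.
  by rewrite (le_trans (bcx _ _))// ler_wpM2l// lerDl.
rewrite -lb; split=> // eps eps0; have [n0 hn0] := cl' _ eps0.
exists (c n0); last by rewrite (ideal_distC hI)// hn0.
by exists (u n0) => //; split; [exact: (hu n0).1|apply: bopBf; [have [] := (hu n0).1|exact: bop_id]].
Qed.

Lemma ideal_closure_opnorm a :
  I a -> norm_closure I N (unitary_orbit dot (bounded_ops H) a)
    `<=` norm_closure (bounded_ops H) (@opnorm R H) (unitary_orbit dot (bounded_ops H) a).
Proof.
move=> Ia b [Ib hb]; split; first exact: (ideal_bop hI Ib).
move=> eps /hb[s Ss bs]; exists s => //; apply: le_lt_trans bs.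
apply: (opnorm_le_ideal_norm he hI); apply: (idealB hI) => //.
exact: (unitary_orbit_ideal Ia Ss).
Qed.

(** * From the orbit condition to separability *)

Definition finite_rank_approximable (a : H -> H) :=
  forall eps : R, 0 < eps -> exists2 f, finite_rank_ops H f & N (a - f) < eps.

(** [u a u^* - a = (u - 1) a u^* + a u^* (1 - u)]. *)
Lemma finite_rank_conj_diff u a : bounded_ops H a ->
  unitary_group dot (finite_rank_ops H) u -> finite_rank_ops H (conj_op u a - a).
Proof.
move=> ba [uu fu]; have [_ u1 u2 cu cu'] := unitaryP he uu.
have -> : conj_op u a - a =
    ((u - idfun) \o (a \o adjoint dot u)) + ((a \o adjoint dot u) \o - (u - idfun)).
  apply/funext => x; rewrite !fctE /=.
  by rewrite opprB (bopB cu'.1) u2 (bopB ba) addrA subrK.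
apply: finite_rank_add; first by apply: finite_rank_comp_right => //; exact: (bop_comp ba cu'.1).
apply: finite_rank_comp_left; first exact: (bop_comp ba cu'.1).
by rewrite -scaleN1r; exact: finite_rank_scale.
Qed.

(** The isometries [s] and [t] put two copies of [a] on orthogonal halves of [H],
    and [w] exchanges the halves. The difference of the two copies is a limit of
    finite-rank operators, and the compression by [t] takes it to [a]. *)
Lemma positive_approximable a : positive_orbits_included dot I N ->
  I a -> positive_op dot a -> finite_rank_approximable a.
Proof.
move=> hpos Ia [ba pa] eps eps0.
have [s [s' [t [t' [as_ at_ ss tt [st ts st1]]]]]] := hilbert_hotel he.
have [bs bs' adjs] := as_; have [bt bt' adjt] := at_.
have E (f g : H -> H) x : f = g -> f x = g x by move=> ->.
have s'sK x : s' (s x) = x by exact: (E _ _ x ss).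
have t'tK x : t' (t x) = x by exact: (E _ _ x tt).
have s't x : s' (t x) = 0 by exact: (E _ _ x st).
have t's x : t' (s x) = 0 by exact: (E _ _ x ts).
have sum1 x : s (s' x) + t (t' x) = x by exact: (E _ _ x st1).
pose b := s \o a \o s'; have Ib : I b := tsiMr hT (tsiMl hT bs Ia) bs'.
have pb : positive_op dot b.
  by split=> [|x]; [exact: (ideal_bop hI Ib)|rewrite /b /= adjs].
pose w := (t \o s') + (s \o t').
have aw : adjoint_pair w w.
  have := adjoint_pairD (adjoint_pair_comp at_ (adjoint_pair_sym as_))
    (adjoint_pair_comp as_ (adjoint_pair_sym at_)).
  by rewrite [X in adjoint_pair _ X -> _]addrC.
have ww : w \o w = idfun.
  apply/funext => x; rewrite /w !fctE /= (bopD bs') (bopD bt').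
  by rewrite s't s'sK t'tK t's add0r addr0 addrC sum1.
have uw := unitary_intro aw ww ww.
have worb : unitary_orbit dot (bounded_ops H) b (conj_op w b).
  exists w => //; split=> //; apply: bopBf; [by have [] := aw|exact: bop_id].
have [Iwb happ] := hpos b Ib pb _ worb.
have [_ [u uF <-] hu] := happ _ eps0.
have bb := ideal_bop hI Ib.
pose f := conj_op u b - b; have ff : finite_rank_ops H f := finite_rank_conj_diff bb uF.
have ct : contractive t.
  split=> // x; rewrite -(@ler_pXn2r _ 2) ?nnegrE ?hnorm_ge0// -lecR -!dotxx.
  by rewrite adjt t'tK.
have ct' := adjoint_contractive at_ ct.
exists (t' \o f \o t); first exact: (finite_rank_comp_right (finite_rank_comp_left bt' ff) bt).
apply: le_lt_trans hu.
have Id : I (conj_op w b - conj_op u b).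
  by apply: (idealB hI) => //; apply: conj_op_ideal => //; exact: uF.1.
have -> : a - (t' \o f \o t) = t' \o (conj_op w b - conj_op u b) \o t.
  apply/funext => x; rewrite /f /conj_op !fctE /= (adjoint_pairE aw) !(bopB bt').
  rewrite /w !fctE /= /b /= !(s't, t's, s'sK, t'tK).
  by rewrite !(bop0 bs, bop0 bt, bop0 ba, bop0 bs', bop0 bt', add0r, addr0, s'sK, t'tK, t's) subr0.
exact: (ideal_norm_comp hI ct' Id ct).
Qed.

Lemma ideal_approximable x : positive_orbits_included dot I N ->
  I x -> finite_rank_approximable x.
Proof.
move=> hpos Ix eps eps0.
have [s [v [w [ps bv bw sE xE]]]] := polar_decomposition he (ideal_bop hI Ix).
have Is : I s by rewrite sE; exact: (tsiMl hT).
have w1 : 0 < opnorm w + 1 by rewrite ltr_wpDl ?opnorm_ge0.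
have [f ff sf] := positive_approximable hpos Is ps (divr_gt0 eps0 w1).
exists (w \o f); first exact: finite_rank_comp_left.
have Isf : I (s - f) by apply: (idealB hI) => //; exact: (finite_rank_ideal hI ff).
have -> : x - (w \o f) = w \o (s - f) \o idfun.
  by rewrite {1}xE; apply/funext => y; rewrite /= !fctE /= (bopB bw).
apply: le_lt_trans (sni_symmetric hI bw Isf bop_id) _.
have N0 := norm_on_ge0 hN Isf; have id1 := contractive_opnorm contractive_id.
rewrite ltr_pdivlMr// in sf; apply: le_lt_trans sf.
apply: (@le_trans _ _ (opnorm w * N (s - f))).
  by rewrite ler_piMr// mulr_ge0 ?opnorm_ge0.
by rewrite mulrC ler_wpM2l// lerDl.
Qed.

(** The finite sums of the operators [d_i d_j^*], for a dense sequence [d], are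
    countably many and dense. *)
Lemma approximable_separable : separable_space H ->
  (forall x, I x -> finite_rank_approximable x) -> separable_on I N.
Proof.
move=> /separable_space_seq[d hd] happ.
pose D (s : seq (nat * nat)) : H -> H :=
  foldr (fun ij x => rank_one (d ij.1) (d ij.2) + x) 0 s.
have ID s : I (D s).
  elim: s => [|ij s IH]; first exact: (tsi0 hT).
  by apply: (tsiD hT _ IH); exact: (ideal_rank_one hI).
have D_cat s1 s2 : D (s1 ++ s2) = D s1 + D s2.
  by elim: s1 => [|ij s1 IH] /=; rewrite ?add0r// IH addrA.
(* [Q] is the closure of these sums; it contains the rank-one operators and is
   closed under addition. *)
pose Q x := I x /\ forall eps : R, 0 < eps -> exists s, N (x - D s) < eps.
have Q0 : Q 0.
  split; first exact: (tsi0 hT).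
  by move=> eps eps0; exists [::]; rewrite /D /= subr0 (ideal_norm0 hI).
have QD x y : Q x -> Q y -> Q (x + y).
  move=> [Ix hx] [Iy hy]; split; first exact: (tsiD hT).
  move=> eps eps0; have eps2 : 0 < eps / 2 by rewrite divr_gt0.
  have [s1 h1] := hx _ eps2; have [s2 h2] := hy _ eps2; exists (s1 ++ s2).
  rewrite D_cat opprD addrACA (le_lt_trans (norm_onD hN _ _))//; try exact: (idealB hI).
  by rewrite [ltRHS]splitr ltrD.
have Q1 f g : Q (rank_one f g).
  split; first exact: (ideal_rank_one hI).
  move=> eps eps0; have eps2 : 0 < eps / 2 by rewrite divr_gt0.
  have g1 : 0 < hnorm g + 1 by rewrite ltr_wpDl ?hnorm_ge0.
  have [i hi] := hd f _ (divr_gt0 eps2 g1).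
  have di1 : 0 < hnorm (d i) + 1 by rewrite ltr_wpDl ?hnorm_ge0.
  have [j hj] := hd g _ (divr_gt0 eps2 di1).
  exists [:: (i, j)]; rewrite /D /= addr0.
  have -> : rank_one f g - rank_one (d i) (d j) =
      rank_one (f - d i) g + rank_one (d i) (g - d j).
    apply/funext => x; rewrite !fctE !rank_oneE linearBr/= scalerBl scalerBr.
    by rewrite addrA subrK.
  rewrite (le_lt_trans (norm_onD hN _ _))//; try exact: (ideal_rank_one hI).
  rewrite [ltRHS]splitr ltrD// (le_lt_trans (ideal_norm_rank_one he hI _ _))//.
    apply: (@le_lt_trans _ _ (hnorm (f - d i) * (hnorm g + 1))).
      by rewrite ler_wpM2l ?hnorm_ge0// lerDl.
    by rewrite -ltr_pdivlMr.
  apply: (@le_lt_trans _ _ ((hnorm (d i) + 1) * hnorm (g - d j))).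
    by rewrite ler_wpM2r ?hnorm_ge0// lerDl.
  by rewrite mulrC -ltr_pdivlMr.
have QF f : finite_rank_ops H f -> Q f.
  move=> [bf /finite_dim_finproj[n [p [fp pf]]]].
  have -> : f = p \o f by apply/funext => x /=; rewrite pf//; exists x.
  have [_ _ af] := adjointP he bf.
  elim: fp {pf} => {n p} [|n p k fp IH k1 pk]; first exact: Q0.
  rewrite (_ : _ \o f = (p \o f) + rank_one k (adjoint dot f k)); first exact: QD.
  by apply/funext => x; rewrite !fctE /= !rank_oneE af.
exists (range D); split.
- exact: (card_le_trans (card_image_le D [set: seq (nat * nat)]) (countableP _)).
- by move=> _ [s _ <-]; exact: ID.
- move=> x Ix; split=> // eps eps0; have eps2 : 0 < eps / 2 by rewrite divr_gt0.
  have [f ff xf] := happ x Ix _ eps2; have [If hf] := QF f ff.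
  have [s fs] := hf _ eps2; exists (D s); first by exists s.
  rewrite (le_lt_trans (ideal_norm_trans hI Ix If (ID s)))//.
  by rewrite [ltRHS]splitr ltrD.
Qed.

Lemma orbit_closures_eq a : separable_on I N -> I a ->
  [/\ norm_closure I N (unitary_orbit dot (finite_rank_ops H) a)
        = norm_closure I N (unitary_orbit dot I a),
      norm_closure I N (unitary_orbit dot I a)
        = norm_closure I N (unitary_orbit dot (bounded_ops H) a) &
      norm_closure I N (unitary_orbit dot (bounded_ops H) a)
        = norm_closure (bounded_ops H) (@opnorm R H)
            (unitary_orbit dot (bounded_ops H) a)].
Proof.
move=> sep Ia; have orbI J := @unitary_orbit_ideal J a Ia.
have cl J K : J `<=` K -> norm_closure I N (unitary_orbit dot J a) `<=`
    norm_closure I N (unitary_orbit dot K a).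
  move=> JK b [Ib hb]; split=> // eps /hb[s Ss bs]; exists s => //.
  exact: (unitary_orbit_mono JK Ss).
have FI := cl _ _ (finite_rank_ideal hI); have IB := cl _ _ (tsi_bounded hT).
have BF : norm_closure I N (unitary_orbit dot (bounded_ops H) a) `<=`
    norm_closure I N (unitary_orbit dot (finite_rank_ops H) a).
  exact: (norm_closure_subset (orbI _) (orbI _) (orbit_in_finite_rank_closure sep Ia)).
split; apply/seteqP; split => //.
- exact: (subset_trans IB BF).
- exact: (subset_trans BF FI).
- exact: ideal_closure_opnorm.
- exact: orbit_opnorm_closure.
Qed.

Lemma separable_normal_orbits : separable_on I N ->
  normal_orbit_closures_included dot I N.
Proof.
move=> sep a Ia _; have [-> -> ->] := orbit_closures_eq sep Ia.
exact: subset_refl.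
Qed.

(** A positive operator is its own adjoint, and an orbit lies in its closure. *)
Lemma normal_positive_orbits : normal_orbit_closures_included dot I N ->
  positive_orbits_included dot I N.
Proof.
move=> hn a Ia pa; have ba := ideal_bop hI Ia; have aa := adjointP he ba.
have na : normal_op dot a by split=> //; rewrite -(positive_selfadj aa pa).
move=> b Ob; apply: (hn a Ia na); have bb := ideal_bop hI (unitary_orbit_ideal Ia Ob).
split=> // eps eps0; exists b => //; rewrite subrr; apply: (le_lt_trans _ eps0).
by apply: opnorm_le => // x; rewrite mul0r hnorm0.
Qed.

End MainIdeal.

End Hilbert.

Theorem theorem4p6 (R : realType) (H : completeNormedModType R[i])
    (dot : {dot H for Num.conj})
    (hdot : hilbert_inner_product dot)
    (Hsep : separable_space H) (Hinf : ~ finite_dim [set: H])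
    (I : set (H -> H)) (N : (H -> H) -> R)
    (hI : symmetrically_normed_ideal dot I N)
    (Iproper : I `<` bounded_ops H) :
  [/\ separable_on I N <-> normal_orbit_closures_included dot I N,
      normal_orbit_closures_included dot I N <-> positive_orbits_included dot I N &
      [\/ separable_on I N, normal_orbit_closures_included dot I N
        | positive_orbits_included dot I N] ->
      forall a : H -> H, I a -> normal_op dot a ->
        [/\ norm_closure I N (unitary_orbit dot (finite_rank_ops H) a)
              = norm_closure I N (unitary_orbit dot I a),
            norm_closure I N (unitary_orbit dot I a)
              = norm_closure I N (unitary_orbit dot (bounded_ops H) a) &
            norm_closure I N (unitary_orbit dot (bounded_ops H) a)
              = norm_closure (bounded_ops H) (@opnorm R H)
                  (unitary_orbit dot (bounded_ops H) a)]].
Proof.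
have [e he] := orthonormal_basis_exists hdot Hsep Hinf.
have sn := separable_normal_orbits hdot he hI.
have np := normal_positive_orbits hdot he hI.
have ps : positive_orbits_included dot I N -> separable_on I N.
  move=> hpos; apply: (approximable_separable hdot he hI Hsep) => x.
  exact: (ideal_approximable hdot he hI hpos).
split; [by split=> // /np/ps|by split=> // /ps/sn|].
move=> h a Ia _; apply: (orbit_closures_eq hdot he hI _ Ia).
by case: h => [|/np/ps|/ps].
Qed.
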